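(* Let $k\ge1$ be an integer and $r>0$. Assume that in the model $dy_t=S(t)dt+d\xi_t$, $0\le t\le n$, for each $n\ge1$ the distribution of $(\xi_t)_{0\le t\le n}$ belongs to a family $\mathcal{Q}_n$ satisfying: $\mathcal{Q}_n\subseteq\{Q:\ \mathbf{L}_{1,n}(Q)+\mathbf{L}_{2,n}(Q)\le l_n\}$, and $$0<\varsigma_*:=\inf_{Q\in\mathcal{Q}_n}\varsigma_Q\le\sup_{Q\in\mathcal{Q}_n}\varsigma_Q=:\varsigma^*<\infty,\qquad \sigma^*:=\sup_{Q\in\mathcal{Q}_n}\sigma_Q<\infty .$$ Let $\widehat S_*$ be the model selection procedure with the weight set $\Gamma=\{\gamma_\alpha,\ \alpha\in\mathcal{A}_n\}$ described in the context, the estimator $\widehat\sigma_n=\sum_{j=l}^n\widehat\theta_{j,n}^2$, $l=[\sqrt n]+1$, and penalty coefficient $\rho=\rho_n>0$ such that $\rho_n\to0$ and $n^\delta\rho_n\to+\infty$ for every $\delta>0$. Then $$\limsup_{n\to\infty}\,n^{2k/(2k+1)}\sup_{S\in W^k_r}\mathcal{R}^*_n(\widehat S_*,S)\le R^*_k,\qquad R^*_k=\bigl((2k+1)r\bigr)^{1/(2k+1)}\left(\frac{\varsigma^*k}{(k+1)\pi}\right)^{2k/(2k+1)},$$ where $W^k_r$ is the Sobolev ball defined in the context.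
   Context: Sobolev ball: $W^k_r=\{f\in\mathcal{C}^k_{per}[0,1]:\ \sum_{j=0}^k\|f^{(j)}\|^2\le r\}$, where $\mathcal{C}^k_{per}[0,1]$ is the set of $k$ times continuously differentiable $f:[0,1]\to\mathbb{R}$ with $f^{(i)}(0)=f^{(i)}(1)$ for $0\le i\le k$ (extended 1-periodically), and $\|f\|^2=\int_0^1f^2(t)dt$. Model: $n$ is a positive integer, $S$ is an unknown 1-periodic function in $L_2[0,1]$, and $(\xi_t)_{0\le t\le n}$ is an unobservable semimartingale with values in the Skorokhod space $\mathcal{D}[0,n]$ whose distribution $Q$ belongs to a family $\mathcal{Q}_n$ of probability measures on $\mathcal{D}[0,n]$. For every $Q\in\mathcal{Q}_n$ and $f\in L_2[0,n]$ the integral $I_n(f)=\int_0^nf_s\,d\xi_s$ is well defined with $\mathbf{E}_QI_n(f)=0$ and $\mathbf{E}_QI_n^2(f)\le\sigma_Q\int_0^nf_s^2ds$, for a constant $\sigma_Q>0$ attached to $Q$. $\mathbf{E}_{Q,S}$ is expectation under the law of $(y_t)_{0\le t\le n}$. Risks: $\mathcal{R}_Q(\widehat S,S)=\mathbf{E}_{Q,S}\|\widehat S-S\|^2$, and robust risk $\mathcal{R}^*_n(\widehat S,S)=\sup_{Q\in\mathcal{Q}_n}\mathcal{R}_Q(\widehat S,S)$. Basis: $\phi_1=1$ and, for $j\ge2$, $\phi_j(x)=\sqrt2\cos(2\pi[j/2]x)$ for even $j$, $\sqrt2\sin(2\pi[j/2]x)$ for odd $j$ ($[\cdot]$ integer part).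 $\xi_{j,n}=n^{-1/2}I_n(\phi_j)$. For a sequence $x=(x_j)$, $|x|^2=\sum_jx_j^2$, $\#(x)=\sum_j\mathbf{1}_{\{|x_j|>0\}}$. To each $Q$ is attached a constant $\varsigma_Q>0$ with $$\mathbf{L}_{1,n}(Q)=\sup_{x\in[-1,1]^\infty,\ \#(x)\le n}\Bigl|\sum_{j\ge1}x_j(\mathbf{E}_Q\xi_{j,n}^2-\varsigma_Q)\Bigr|<\infty,\qquad \mathbf{L}_{2,n}(Q)=\sup_{|x|\le1,\ \#(x)\le n}\mathbf{E}_Q\Bigl(\sum_{j\ge1}x_j(\xi_{j,n}^2-\mathbf{E}_Q\xi_{j,n}^2)\Bigr)^2<\infty .$$ $(l_n)$ is a fixed positive increasing sequence with $l_n\to\infty$ and $l_n/n^\delta\to0$ for every $\delta>0$. The constants $\varsigma_*,\varsigma^*,\sigma^*$ do not depend on $n$. Estimators: $\widehat\theta_{j,n}=\frac1n\int_0^n\phi_j(t)dy_t$; $\widehat S_\gamma=\sum_{j\ge1}\gamma(j)\widehat\theta_{j,n}\phi_j$; $\widetilde\theta_{j,n}=\widehat\theta_{j,n}^2-\widehat\sigma_n/n$; $\widehat P_n(\gamma)=\widehat\sigma_n|\gamma|^2/n$; $J_n(\gamma)=\sum_j\gamma^2(j)\widehat\theta_{j,n}^2-2\sum_j\gamma(j)\widetilde\theta_{j,n}+\rho\widehat P_n(\gamma)$. $\widehat\gamma$ is a minimizer of $J_n$ over $\Gamma$ and $\widehat S_*=\widehat S_{\widehat\gamma}$. Weights: $\mathcal{A}_n=\{1,\dots,k^*\}\times\{t_1,\dots,t_m\}$,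 $t_i=i\varepsilon$, $m=[1/\varepsilon^2]$, where $k^*=k^*(n)\ge1$ (integer) and $0<\varepsilon=\varepsilon(n)\le1$ satisfy $k^*(n)\to\infty$, $k^*(n)/\ln n\to0$, $\varepsilon(n)\to0$ and $n^\delta\varepsilon(n)\to+\infty$ for every $\delta>0$. For $\alpha=(\beta,t)\in\mathcal{A}_n$, $$\gamma_\alpha(j)=\mathbf{1}_{\{1\le j\le j_0\}}+\bigl(1-(j/\omega_\alpha)^\beta\bigr)\mathbf{1}_{\{j_0<j\le\omega_\alpha\}},\quad j_0=[\omega_\alpha/\ln n],\quad \omega_\alpha=(\tau_\beta\,t\,n)^{1/(2\beta+1)},\quad \tau_\beta=\frac{(\beta+1)(2\beta+1)}{\pi^{2\beta}\beta}.$$ *)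

(* Defs.v *)
From HB Require Import structures.
From mathcomp Require Import all_boot all_order all_algebra.
From mathcomp Require Import all_classical all_reals all_analysis.
Set Implicit Arguments.
Unset Strict Implicit.
Unset Printing Implicit Defensive.
Import Order.TTheory GRing.Theory Num.Theory.
Import numFieldNormedType.Exports.
Local Open Scope classical_set_scope.
Local Open Scope ring_scope.

Definition cadlag (R : realType) (T : R) (x : R -> R) : Prop :=
  (forall t, 0 <= t < T -> x @ t^'+ --> x t) /\
  (forall t, 0 < t <= T -> cvg (x @ t^'-)).

(* Paths are total functions R -> R; the value 0 imposed outside [0, T] makes
   the type equal to D[0, T] under Leibniz equality. *)
Record skorokhod (R : realType) (T : R) : Type := Skorokhod {
  traj : R -> R ;
  traj_cadlag : cadlag T traj ;
  traj_out : forall t, ~~ (0 <= t <= T) -> traj t = 0 }.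

Lemma cadlag0 (R : realType) (T : R) : cadlag T (fun=> 0).
Proof.
split=> t _; first exact: cvg_cst.
by apply/cvg_ex; exists 0; exact: cvg_cst.
Qed.

HB.instance Definition _ (R : realType) (T : R) := gen_eqMixin (skorokhod T).
HB.instance Definition _ (R : realType) (T : R) :=
  gen_choiceMixin (skorokhod T).
HB.instance Definition _ (R : realType) (T : R) :=
  isPointed.Build (skorokhod T)
    (@Skorokhod R T _ (@cadlag0 R T) (fun _ _ => erefl)).

Definition cylinders (R : realType) (T : R) : set (set (skorokhod T)) :=
  [set C | exists t : R, exists B : set R,
    [/\ 0 <= t <= T, measurable B & C = [set w | B (traj w t)]]].

(* The sigma-algebra generated by the coordinates is the Borel sigma-algebra
   of the Skorokhod topology. *)
Definition DT (R : realType) (T : R) := g_sigma_algebraType (@cylinders R T).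

Section semimartingale.
Context (R : realType) (d : measure_display) (Om : measurableType d).
Context (P : probability Om R) (T : R) (F : R -> set (set Om)).
Local Open Scope ereal_scope.

Definition filtration : Prop :=
  (forall t, (0 <= t <= T)%R ->
     sigma_algebra setT (F t) /\ F t `<=` measurable) /\
  (forall s t, (0 <= s)%R -> (s <= t)%R -> (t <= T)%R -> F s `<=` F t).

Definition adapted (X : R -> Om -> R) : Prop :=
  forall t, (0 <= t <= T)%R ->
  forall B : set R, measurable B -> F t (X t @^-1` B).

Definition martingale (X : R -> Om -> R) : Prop :=
  [/\ adapted X,
      forall t, (0 <= t <= T)%R -> P.-integrable setT (EFin \o X t) &
      forall s t A, (0 <= s)%R -> (s <= t)%R -> (t <= T)%R -> F s A ->
        \int[P]_(w in A) (X t w)%:E = \int[P]_(w in A) (X s w)%:E].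

Definition stopping_time (tau : Om -> R) : Prop :=
  (forall w, (0 <= tau w)%R) /\
  (forall t, (0 <= t <= T)%R -> F t [set w | (tau w <= t)%R]).

Definition local_martingale (M : R -> Om -> R) : Prop :=
  [/\ adapted M, forall w, cadlag T (M ^~ w) &
   exists tau : nat -> Om -> R,
    [/\ forall k, stopping_time (tau k),
        forall k w, (tau k w <= tau k.+1 w)%R,
        {ae P, forall w, exists k, (T <= tau k w)%R} &
        forall k, martingale
          (fun t w => M (Num.min t (tau k w)) w - M 0%R w)%R]].

Definition finite_variation_process (A : R -> Om -> R) : Prop :=
  [/\ adapted A, forall w, cadlag T (A ^~ w) &
      forall w, bounded_variation 0%R T (A ^~ w)].

Definition semimartingale (X : R -> Om -> R) : Prop :=
  adapted X /\
  exists M A : R -> Om -> R,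
    [/\ local_martingale M, finite_variation_process A,
        forall w, M 0%R w = 0%R /\ A 0%R w = 0%R &
        forall t w, (0 <= t <= T)%R -> (X t w = X 0 w + M t w + A t w)%R].

End semimartingale.

(* No usual conditions on the filtration: passing to the usual augmentation
   preserves semimartingales, so the class of laws is the same. *)
Definition semimartingale_law (R : realType) (T : R)
    (Q : probability (DT T) R) : Prop :=
  exists (d : measure_display) (Om : measurableType d) (P : probability Om R)
    (F : R -> set (set Om)) (xi : Om -> DT T),
  [/\ measurable_fun setT xi, filtration T F,
      semimartingale P T F (fun t w => traj (xi w) t) &
      forall A : set (DT T), measurable A -> Q A = P (xi @^-1` A)].

Section model.
Context (R : realType).
Local Notation mu := (@lebesgue_measure R).

(* Sum over j >= 1; only used for sequences with finite support. *)
Definition sum_ge1 (u : nat -> R) : R := \big[+%R/0]_(1 <= j <oo) u j.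

Definition L2 (T : R) (f : R -> R) : Prop :=
  measurable_fun `[0, T] f /\
  (\int[mu]_(t in `[0%R, T]) ((f t) ^+ 2)%:E < +oo)%E.

(* Integral of deterministic functions against the canonical process under Q.
   Step functions are dense in L2[0, T], so the second moment bound makes
   linearity and the value on indicators of ]s, t] determine I f up to
   Q-null sets; I f is then the stochastic integral of f. *)
Definition stochastic_integral (T : R) (Q : probability (DT T) R) (sigmaQ : R)
    (I : (R -> R) -> DT T -> R) : Prop :=
  [/\ forall f, L2 T f -> measurable_fun setT (I f),
      forall (a : R) f g, L2 T f -> L2 T g ->
        {ae Q, forall w, I (fun t => a * f t + g t) w = a * I f w + I g w},
      forall s t : R, 0 <= s -> s <= t -> t <= T ->
        {ae Q, forall w, I (\1_(`]s, t])) w = traj w t - traj w s},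
      forall f, L2 T f -> ('E_Q[I f] = 0)%E &
      forall f, L2 T f ->
        ('E_Q[(fun w => I f w ^+ 2)%R] <=
           sigmaQ%:E * \int[mu]_(t in `[0%R, T]) ((f t) ^+ 2)%:E)%E].

Definition phi (j : nat) (x : R) : R :=
  if j == 1%N then 1
  else if odd j then Num.sqrt 2 * sin (2 * pi * (j./2)%:R * x)
  else Num.sqrt 2 * cos (2 * pi * (j./2)%:R * x).

Section fixed_n.
Context (n : nat).
Local Notation D := (DT (n%:R : R)).

Definition xi_coef (I : (R -> R) -> D -> R) (j : nat) (w : D) : R :=
  (Num.sqrt n%:R)^-1 * I (phi j) w.

(* #(x) <= n *)
Definition card_supp_le (x : nat -> R) : Prop :=
  ([set j | (1 <= j)%N /\ 0 < `|x j|] #<= `I_n)%card.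

Definition L1n (Q : probability D R) (I : (R -> R) -> D -> R)
    (varsigmaQ : R) : \bar R :=
  ereal_sup [set `| sum_ge1 (fun j =>
      x j * (fine 'E_Q[(fun w => xi_coef I j w ^+ 2)%R]%E - varsigmaQ)) |%:E
    | x in [set x : nat -> R |
        (forall j, -1 <= x j <= 1) /\ card_supp_le x]].

Definition L2n (Q : probability D R) (I : (R -> R) -> D -> R) : \bar R :=
  ereal_sup [set 'E_Q[(fun w => (sum_ge1 (fun j =>
      x j * (xi_coef I j w ^+ 2 -
             fine 'E_Q[(fun w' => xi_coef I j w' ^+ 2)%R]%E))) ^+ 2)%R]%E
    | x in [set x : nat -> R |
        card_supp_le x /\ sum_ge1 (fun j => x j ^+ 2) <= 1]].

(* The path (y_t)_(0 <= t <= n) with noise path w. *)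
Definition observation (S : R -> R) (w : D) (t : R) : R :=
  if 0 <= t <= n%:R then (\int[mu]_(s in `[0, t]) S s) + traj w t else 0.

(* (1/n) \int_0^n phi_j dy, with dy = S dt + dxi. *)
Definition theta_hat (I : (R -> R) -> D -> R) (S : R -> R) (w : D)
    (j : nat) : R :=
  n%:R^-1 * (\int[mu]_(t in `[0, n%:R]) (phi j t * S t) + I (phi j) w).

(* In the next definitions th is the sequence of estimated coefficients. *)
Definition S_hat (gam th : nat -> R) (x : R) : R :=
  sum_ge1 (fun j => gam j * th j * phi j x).

Definition sigma_hat (th : nat -> R) : R :=
  \sum_((Num.truncn (Num.sqrt (n%:R : R))).+1 <= j < n.+1) th j ^+ 2.

Definition theta_tilde (th : nat -> R) (j : nat) : R :=
  th j ^+ 2 - sigma_hat th / n%:R.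

Definition P_hat (th gam : nat -> R) : R :=
  sigma_hat th * sum_ge1 (fun j => gam j ^+ 2) / n%:R.

Definition J_cost (rho : R) (th gam : nat -> R) : R :=
  sum_ge1 (fun j => gam j ^+ 2 * th j ^+ 2)
  - 2 * sum_ge1 (fun j => gam j * theta_tilde th j)
  + rho * P_hat th gam.

Definition is_minimizer (Gam : set (nat -> R)) (rho : R)
    (th gam : nat -> R) : Prop :=
  Gam gam /\ forall g, Gam g -> J_cost rho th gam <= J_cost rho th g.

Definition tau_w (b : nat) : R :=
  (b.+1)%:R * (2 * b + 1)%:R / (pi ^+ (2 * b) * b%:R).

Definition omega_w (b : nat) (t : R) : R :=
  (tau_w b * t * n%:R) `^ ((2 * b + 1)%:R^-1).

Definition gamma_w (b : nat) (t : R) (j : nat) : R :=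
  let j0 := Num.truncn (omega_w b t / ln n%:R) in
  if (1 <= j <= j0)%N then 1
  else if (j0 < j)%N && (j%:R <= omega_w b t)
       then 1 - (j%:R / omega_w b t) ^+ b
  else 0.

Definition A_grid (kstar : nat) (eps : R) : set (nat * R) :=
  [set a | (1 <= a.1 <= kstar)%N /\
     exists i : nat, (1 <= i <= Num.truncn (eps ^- 2))%N /\ a.2 = i%:R * eps].

Definition Gamma_set (kstar : nat) (eps : R) : set (nat -> R) :=
  [set gamma_w a.1 a.2 | a in A_grid kstar eps].

(* gamma_hat maps the observed path to a weight. *)
Definition risk (Q : probability D R) (I : (R -> R) -> D -> R)
    (gamma_hat : (R -> R) -> nat -> R) (S : R -> R) : \bar R :=
  (\int[Q]_w \int[mu]_(x in `[0%R, 1%R])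
     ((S_hat (gamma_hat (observation S w)) (theta_hat I S w) x - S x)
        ^+ 2)%:E)%E.

Definition robust_risk (Qn : set (probability D R))
    (I : probability D R -> (R -> R) -> D -> R)
    (gamma_hat : (R -> R) -> nat -> R) (S : R -> R) : \bar R :=
  ereal_sup [set risk Q (I Q) gamma_hat S | Q in Qn].

End fixed_n.

Definition signal (S : R -> R) : Prop :=
  (forall x, S (x + 1) = S x) /\ L2 1 S.

(* Elements of C^k_per[0,1] are identified with their 1-periodic extensions. *)
Definition Ck_per (k : nat) (f : R -> R) : Prop :=
  [/\ forall x, f (x + 1) = f x,
      forall i x, (i < k)%N -> derivable (derive1n i f) x 1,
      forall i, (i <= k)%N -> continuous (derive1n i f) &
      forall i, (i <= k)%N -> derive1n i f 0 = derive1n i f 1].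

Definition sobolev_ball (k : nat) (r : R) : set (R -> R) :=
  [set f | Ck_per k f /\
    \sum_(0 <= j < k.+1) \int[mu]_(t in `[0, 1]) (derive1n j f t ^+ 2) <= r].

Definition pinsker_constant (k : nat) (r vs : R) : R :=
  ((2 * k + 1)%:R * r) `^ ((2 * k + 1)%:R^-1) *
  (vs * k%:R / (k.+1%:R * pi)) `^ ((2 * k)%:R / (2 * k + 1)%:R).

End model.

(* Main.v *)
Require Import Defs.
From mathcomp Require Import all_boot all_order all_algebra.
From mathcomp Require Import all_classical all_reals all_analysis.
From mathcomp Require Import measurable_realfun.
From mathcomp Require Import ring lra zify.
Set Implicit Arguments.
Unset Strict Implicit.
Unset Printing Implicit Defensive.
Import Order.TTheory GRing.Theory Num.Theory.
Import numFieldNormedType.Exports.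
Local Open Scope classical_set_scope.
Local Open Scope ring_scope.

(** In the trigonometric basis the model is a sequence of observed coefficients,
    true coefficient plus noise of variance about [vs / n], and the loss of the
    estimator with weight [g] is the squared distance of the weighted observed
    coefficients to the true ones. Replacing the squared noises by their common
    level and the linear noise by 0 turns this loss into the proxy risk
    [sum (1 - g j)^2 theta j^2 + vs * sum g j^2 / n].

    The data-driven choice is almost as good as any fixed weight. The minimized
    cost differs from the proxy risk, up to a term common to all weights, by noise
    of the same kind as the loss does ([lossE], [costE]). Each noise is compared
    with the proxy risk of its own weight by [2 |x| <= e c + x^2 / (e c)]
    ([noise_bound]): a fraction [eta] of the proxy risk absorbs it, and the
    remainder, summed over the finite family, has mean of order
    [#weights * l_n / (eta n)], that is [n^-1] up to arbitrarily small powers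
    ([oracle_mean]). The estimated variance errs by about [n^-1/2]
    ([variance_estimator_error]); multiplied by the mass of a weight, at most
    of order [n^(1/3)] up to small powers, and divided by [n], this is negligible
    with respect to the rate. The penalty vanishes because [rho] tends to 0.

    It remains to bound the proxy risk of one well chosen weight, the one with
    smoothness [k] and the grid point next to [r / vs_up]. On the Sobolev ball the
    weighted sum of squared coefficients is at most [r] ([sobolev_bound], by
    Bessel's inequality for the [k]-th derivative), so the bias is at most [r]
    times the largest ratio of [(1 - g j)^2] to the ellipsoid weight
    ([gamma_w_bias]), while the variance is a Riemann sum ([gamma_w_sqnorm]). The
    sum of the two limits is the Pinsker constant ([main_cvg], [limit_valueE]).
    The limsup is then at most a factor depending on [eta] times this constant,
    and [eta] is arbitrary.

    The energy of the signal beyond frequency [n] also enters the loss. It is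
    negligible by the completeness of the trigonometric basis for continuously
    differentiable periodic functions ([parseval]), which comes from the identity
    [sum of N residuals = 1/2 * double integral of (S x - S t)^2 times the sum of N
    Dirichlet kernels], where the integrand is bounded uniformly in [N]. *)



(** * Integrals of continuous functions *)

Section integral.
Context (R : realType).
Local Notation mu := (@lebesgue_measure R).
Implicit Types f g : R -> R.

Lemma integrable_continuous (a b : R) f :
  continuous f -> mu.-integrable `[a, b] (EFin \o f).
Proof.
move=> cf; apply: continuous_compact_integrable; first exact: segment_compact.
exact: continuous_subspaceT.
Qed.

Definition int01 f : R := \int[mu]_(t in `[0, 1]) f t.

Lemma int01D f g : continuous f -> continuous g ->
  int01 (fun t => f t + g t) = int01 f + int01 g.
Proof. by move=> cf cg; rewrite /int01 RintegralD//; exact: integrable_continuous. Qed.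

Lemma int01Z c f : continuous f -> int01 (fun t => c * f t) = c * int01 f.
Proof. by move=> cf; rewrite /int01 RintegralZl//; exact: integrable_continuous. Qed.

Lemma int01_cst c : int01 (fun=> c) = c.
Proof.
rewrite /int01 Rintegral_cst//= lebesgue_measure_itv/= lte_fin ltr01.
by rewrite oppr0 addr0/= mulr1.
Qed.

Lemma int01_ge0 f : (forall t, 0 <= f t) -> 0 <= int01 f.
Proof. by move=> f0; apply: Rintegral_ge0. Qed.

Lemma int01_le f g : continuous f -> continuous g ->
  (forall t, 0 <= t <= 1 -> f t <= g t) -> int01 f <= int01 g.
Proof.
by move=> cf cg fg; apply: le_Rintegral => //; exact: integrable_continuous.
Qed.

Lemma continuous_sum (I : Type) (s : seq I) (P : pred I) (F : I -> R -> R) :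
  (forall i, continuous (F i)) -> continuous (fun t => \sum_(i <- s | P i) F i t).
Proof.
move=> cF; elim: s => [|i s IH].
  rewrite (_ : (fun _ => _) = cst 0) => [x|]; first exact: cvg_cst.
  by apply/funext => t; rewrite big_nil.
rewrite (_ : (fun _ => _) = if P i then F i \+ (fun t => \sum_(i <- s | P i) F i t)
  else (fun t => \sum_(i <- s | P i) F i t)); last first.
  by apply/funext => t; rewrite big_cons; case: ifP.
by case: ifP => // _ x; apply: cvgD; [exact: cF|exact: IH].
Qed.

Lemma int01_sum (I : Type) (s : seq I) (P : pred I) (F : I -> R -> R) :
  (forall i, continuous (F i)) ->
  int01 (fun t => \sum_(i <- s | P i) F i t) = \sum_(i <- s | P i) int01 (F i).
Proof.
move=> cF; elim: s => [|i s IH].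
  rewrite big_nil -[RHS]int01_cst; congr int01.
  by apply/funext => t; rewrite big_nil.
rewrite big_cons; case: ifP => Pi; last first.
  by rewrite -IH; congr int01; apply/funext => t; rewrite big_cons Pi.
rewrite -IH -int01D//; last exact: continuous_sum.
by congr int01; apply/funext => t; rewrite big_cons Pi.
Qed.

Lemma int_FTC (a b : R) f F : a < b -> continuous f ->
  (forall x, a <= x <= b -> is_derive x (1:R) F (f x)) ->
  \int[mu]_(t in `[a, b]) f t = F b - F a.
Proof.
move=> ab cf dF.
have dvF x : a <= x <= b -> derivable F x 1 by move=> /dF[].
have cF x : a <= x <= b -> {for x, continuous F}.
  by move=> /dvF dx; apply/differentiable_continuous/derivable1_diffP.
rewrite /Rintegral (@continuous_FTC2 _ f F)//.
- exact: continuous_subspaceT.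
- split.
  + by move=> x; rewrite in_itv/= => /andP[ax xb]; apply: dvF; rewrite !ltW.
  + by apply/cvg_at_right_filter/cF; rewrite lexx ltW.
  + by apply/cvg_at_left_filter/cF; rewrite lexx ltW.
- move=> x; rewrite in_itv/= => /andP[ax xb]; rewrite derive1E.
  by apply: derive_val; apply: dF; rewrite !ltW.
Qed.

Lemma int01_FTC f F : continuous f -> (forall x, is_derive x (1:R) F (f x)) ->
  int01 f = F 1 - F 0.
Proof. by move=> cf dF; rewrite /int01 (@int_FTC 0 1 f F)// => x _; exact: dF. Qed.

Lemma primitive_derive f (a x : R) : continuous f -> a < x ->
  is_derive x (1:R) (fun y => \int[mu]_(t in `[a, y]) f t) (f x).
Proof.
move=> cf ax.
have xx1 : x < x + 1 by rewrite ltrDl.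
have [d e] := @continuous_FTC1_closed _ f a x (x + 1) xx1
  (integrable_continuous _ _ cf) ax (cf x).
by rewrite derive1E in e; exact: (DeriveDef d e).
Qed.

(** The primitive based at -1 is differentiable at 0, so its increment over
    [m, m + 1] is the integral there; the same integral computed from the
    shifted primitive gives the increment over [0, 1]. *)
Lemma int_periodic f (n : nat) : continuous f -> (forall x, f (x + 1) = f x) ->
  \int[mu]_(t in `[0, n%:R]) f t = n%:R * int01 f.
Proof.
move=> cf pf.
pose G (y : R) : R := \int[mu]_(t in `[-1, y]) f t.
have dG (x : R) : -1 < x -> is_derive x (1:R) G (f x) by exact: primitive_derive.
have fn (m : nat) x : f (x - m%:R) = f x.
  elim: m x => [|m IH] x; first by rewrite subr0.
  by rewrite -[RHS]IH -(pf (x - m.+1%:R)); congr f; rewrite -natr1; ring.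
have dG' (a b : R) : 0 <= a -> forall x : R, a <= x <= b -> is_derive x (1:R) G (f x).
  by move=> a0 x /andP[ax _]; apply: dG; lra.
have step (m : nat) : G m.+1%:R - G m%:R = G 1 - G 0.
  have m0 : 0 <= m%:R :> R by [].
  have mm : m%:R < m.+1%:R :> R by rewrite ltr_nat.
  have e1 := int_FTC mm cf (dG' _ _ m0).
  have e2 : \int[mu]_(t in `[m%:R, m.+1%:R]) f t = G (m.+1%:R - m%:R) - G (m%:R - m%:R).
    apply: (@int_FTC _ _ f (fun y : R => G (y - m%:R))) => // x /andP[mx _].
    rewrite -(fn m x) -[f _]mulr1; apply: is_derive1_comp; first by apply: dG; lra.
    by apply: is_derive_eq; rewrite subr0.
  by move: e1; rewrite e2 /= subrr -natr1 addrAC subrr add0r => ->.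
have GE (m : nat) : G m%:R - G 0 = m%:R * (G 1 - G 0).
  elim: m => [|m IH]; first by rewrite mul0r subrr.
  by rewrite -[m.+1 in RHS]addn1 natrD mulrDl -IH mul1r -(step m); ring.
rewrite /int01 (int_FTC ltr01 cf (dG' _ _ (lexx 0))).
case: n => [|n]; first by rewrite mul0r set_itv1 Rintegral_set1.
by rewrite (int_FTC (ltr0Sn _ n) cf (dG' _ _ (lexx 0))).
Qed.

End integral.


(** * The trigonometric basis and its kernels *)

Section basis.
Context (R : realType).
Local Notation mu := (@lebesgue_measure R).
Local Notation phi := (@phi R).
Implicit Types f g : R -> R.

Definition freq (j : nat) : R := 2 * pi * (j./2)%:R.

Lemma phi1 x : phi 1 x = 1. Proof. by []. Qed.

Lemma phi_even m x : phi m.*2 x = Num.sqrt 2 * cos (2 * pi * m%:R * x).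
Proof.
rewrite /Defs.phi odd_double doubleK.
by case: eqP => // /(congr1 odd); rewrite odd_double.
Qed.

Lemma phi_odd m x : (0 < m)%N ->
  phi m.*2.+1 x = Num.sqrt 2 * sin (2 * pi * m%:R * x).
Proof.
case: m => // m _; rewrite /Defs.phi oddS odd_double/= uphalf_double.
by [].
Qed.

Lemma sqrt2K : Num.sqrt 2 * Num.sqrt 2 = 2 :> R.
Proof. by rewrite -expr2 sqr_sqrtr. Qed.

Lemma is_derive_scale f (a c x d : R) : is_derive (c * x) (1:R) f d ->
  is_derive x (1:R) (fun y => a * f (c * y)) (a * (c * d)).
Proof.
move=> df.
have dc : is_derive x (1:R) (fun y : R => c * y) c.
  have := @is_deriveZ _ _ _ id c x 1 1 _.
  by rewrite /GRing.scale/= mulr1; apply.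
have := @is_derive1_comp _ f (fun y => c * y) x _ _ df dc => dfc.
have := @is_deriveZ _ _ _ _ a _ _ _ dfc.
by rewrite /GRing.scale/= [d * c]mulrC; apply.
Qed.

(** Differentiation exchanges the cosine and the sine of a frequency. Integration
    by parts and orthogonality are read off this single formula. *)
Lemma phi_derive j x : is_derive x (1:R) (phi j)
  ((-1) ^+ (~~ odd j) * freq j * phi (if odd j then j.-1 else j.+1) x).
Proof.
have [->|j1] := eqVneq j 1%N.
  rewrite /freq/= !(mulr0,mul0r).
  rewrite (_ : phi 1 = cst 1)//.
  exact: is_derive_cst.
have [jo|je] := boolP (odd j).
  case: j jo j1 => // j /=; rewrite /freq /= => je j1.
  have je' : j = (j./2).*2 by rewrite -[LHS]odd_double_half (negbTE je).
  have m0 : (0 < j./2)%N by case: j je j1 {je'} => [|[|]].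
  rewrite uphalf_half (negbTE je) add0n.
  move: m0 je'; set m := j./2 => m0 ->.
  rewrite (_ : phi m.*2.+1 = fun x => Num.sqrt 2 * sin (2 * pi * m%:R * x)); last first.
    by apply/funext => y; rewrite phi_odd.
  rewrite phi_even expr0 mul1r mulrCA; apply: is_derive_scale.
rewrite expr1 /freq.
have je' : j = (j./2).*2 by rewrite -[LHS]odd_double_half (negbTE je).
have [m0|m0] := posnP j./2.
  rewrite m0 !(mulr0,mul0r) je' m0.
  rewrite (_ : phi 0.*2 = cst (Num.sqrt 2)); first exact: is_derive_cst.
  by apply/funext => y; rewrite phi_even mulr0 mul0r cos0 mulr1.
move: m0 je'; set m := j./2 => m0 ->.
rewrite phi_odd// (_ : phi m.*2 = fun x => Num.sqrt 2 * cos (2 * pi * m%:R * x)); last first.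
  by apply/funext => y; rewrite phi_even.
rewrite (_ : -1 * _ * _ = Num.sqrt 2 * (2 * pi * m%:R * - sin (2 * pi * m%:R * x))).
  exact: is_derive_scale.
by ring.
Qed.

Lemma phi_continuous j : continuous (phi j).
Proof.
move=> x; apply/differentiable_continuous/derivable1_diffP.
by have [] := phi_derive j x.
Qed.

Lemma cos_freq_periodic (m : nat) x : cos (x + 2 * pi * m%:R) = cos x :> R.
Proof.
elim: m x => [|m IH] x; first by rewrite mulr0 addr0.
have -> : x + 2 * pi * m.+1%:R = x + 2 * pi * m%:R + pi *+ 2.
  by rewrite -natr1 mulr2n; ring.
by rewrite cosD2pi IH.
Qed.

Lemma sin_freq_periodic (m : nat) x : sin (x + 2 * pi * m%:R) = sin x :> R.
Proof.
elim: m x => [|m IH] x; first by rewrite mulr0 addr0.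
have -> : x + 2 * pi * m.+1%:R = x + 2 * pi * m%:R + pi *+ 2.
  by rewrite -natr1 mulr2n; ring.
by rewrite sinD2pi IH.
Qed.

Lemma phi_periodic j x : phi j (x + 1) = phi j x.
Proof.
rewrite /Defs.phi; case: eqP => // _.
rewrite (_ : 2 * pi * (j./2)%:R * (x + 1) = 2 * pi * (j./2)%:R * x + 2 * pi * (j./2)%:R).
  by rewrite cos_freq_periodic sin_freq_periodic.
by ring.
Qed.

Lemma sum_pairs (F : nat -> R) (M : nat) :
  \sum_(1 <= j < M.*2.+2) F j =
  F 1%N + \sum_(1 <= m < M.+1) (F m.*2 + F m.*2.+1).
Proof.
elim: M => [|M IH]; first by rewrite big_nat1 big_geq ?addr0.
rewrite doubleS [in LHS]big_nat_recr//= [in LHS]big_nat_recr//= IH.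
by rewrite [in RHS]big_nat_recr//= -!addrA.
Qed.

Lemma phi_energy m x : (0 < m)%N -> phi m.*2 x ^+ 2 + phi m.*2.+1 x ^+ 2 = 2.
Proof.
move=> m0; rewrite phi_even phi_odd// !exprMn -mulrDr cos2Dsin2 mulr1.
by rewrite expr2 sqrt2K.
Qed.

Lemma dirichlet_kernel (M : nat) x t :
  \sum_(1 <= j < M.*2.+2) phi j x * phi j t =
  1 + 2 * \sum_(1 <= m < M.+1) cos (2 * pi * m%:R * (x - t)).
Proof.
rewrite sum_pairs !phi1 mulr1; congr (_ + _).
rewrite mulr_sumr; apply: eq_big_nat => m /andP[m0 _].
rewrite !phi_even !phi_odd// mulrBr cosB.
have := sqrt2K; set s := Num.sqrt 2.
set a := 2 * pi * m%:R * x; set b := 2 * pi * m%:R * t => s2.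
transitivity (s * s * (cos a * cos b + sin a * sin b)); first by ring.
by rewrite s2.
Qed.

(** Telescoping: multiplication by [sin u] turns the Dirichlet kernel into one
    sine. *)
Lemma sin_dirichlet (M : nat) (u : R) :
  sin u * (1 + 2 * \sum_(1 <= m < M.+1) cos (2 * m%:R * u)) =
  sin ((2 * M%:R + 1) * u).
Proof.
elim: M => [|M IH].
  by rewrite big_geq// !mulr0 addr0 add0r !mul1r mulr1.
rewrite big_nat_recr//=; move: IH.
set S := \sum_(1 <= m < M.+1) _; set c := cos _ => IH.
rewrite (_ : sin u * _ = sin u * (1 + 2 * S) + 2 * (sin u * c)); last by ring.
rewrite {}IH {S}/c.
have -> : (2 * M%:R + 1) * u = 2 * M.+1%:R * u - u by rewrite -natr1; ring.
have -> : (2 * M.+1%:R + 1) * u = 2 * M.+1%:R * u + u by ring.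
by rewrite sinB sinD; ring.
Qed.

(** The sum of the Dirichlet kernels is nonnegative and of size
    [(sin u)^-2], uniformly in their number. This is the only property of
    summability kernels used for the completeness of the basis. *)
Lemma fejer_kernel (N : nat) (u : R) :
  sin u ^+ 2 * \sum_(0 <= M < N) (1 + 2 * \sum_(1 <= m < M.+1) cos (2 * m%:R * u)) =
  sin (N%:R * u) ^+ 2.
Proof.
elim: N => [|N IH]; first by rewrite big_geq// mulr0 mul0r sin0 expr0n.
rewrite big_nat_recr//= mulrDr IH [in X in _ + X]expr2 -mulrA sin_dirichlet.
have -> : (2 * N%:R + 1) * u = N.+1%:R * u + N%:R * u by rewrite -natr1; ring.
have -> : sin u = sin (N.+1%:R * u - N%:R * u) by congr sin; rewrite -natr1; ring.
rewrite sinB sinD.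
have := cos2Dsin2 (N%:R * u); have := cos2Dsin2 (N.+1%:R * u).
set a := cos (N.+1%:R * u); set b := sin (N.+1%:R * u).
set c := cos (N%:R * u); set d := sin (N%:R * u) => h1 h2.
have e1 : a ^+ 2 = 1 - b ^+ 2 by rewrite -h1; ring.
have e2 : c ^+ 2 = 1 - d ^+ 2 by rewrite -h2; ring.
rewrite (_ : (b * c - a * d) * (b * c + a * d) = b ^+ 2 * c ^+ 2 - a ^+ 2 * d ^+ 2); last ring.
by rewrite e1 e2; ring.
Qed.

(** Halving the angle avoids concavity: [sin v = 2 sin (v/2) cos (v/2)], the mean
    value theorem gives [sin (v/2) >= (v/2) cos (v/2)], and
    [2 cos (v/2) ^ 2 = 1 + cos v >= 1]. *)
Lemma sin_ge_half (v : R) : 0 <= v <= pi / 2 -> v / 2 <= sin v.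
Proof.
move=> /andP[v0 vpi].
have [v00|v00] := eqVneq v 0; first by rewrite v00 sin0 mul0r.
set w := v / 2.
have w0 : 0 < w by rewrite divr_gt0// lt_neqAle eq_sym v00.
have vw : v = w *+ 2 by rewrite mulr2n /w; field.
have cw : continuous (@sin R) by exact: continuous_sin.
have [c] := @MVT R sin cos 0 w w0 (fun x _ => is_derive_sin x) (continuous_subspaceT cw).
rewrite in_itv/= => /andP[c0 cltw]; rewrite sin0 !subr0 => sw.
have pi2 := @pi_gt0 R.
have cosw : cos w <= cos c.
  by apply/ltW; rewrite ltr_cos// in_itv/=; apply/andP; split; lra.
have cosw0 : 0 <= cos w by apply: cos_ge0_pihalf; apply/andP; split; lra.
have : 0 <= cos (w *+ 2) by rewrite -vw; apply: cos_ge0_pihalf; apply/andP; split; lra.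
rewrite cos_mulr2n => h.
rewrite [in leRHS]vw sin_mulr2n sw.
have : cos w * cos w <= cos c * cos w by rewrite ler_wpM2r.
move: h; rewrite expr2 !mulr2n; set a := cos w * cos w => h1 h2.
have : 1 / 2 <= cos w * cos c by rewrite mulrC; lra.
move=> h3; have : w * (1/2) <= w * (cos w * cos c) by rewrite ler_pM2l.
by lra.
Qed.

End basis.


(** * Orthonormality *)

Section fourier.
Context (R : realType).
Local Notation mu := (@lebesgue_measure R).
Local Notation phi := (@phi R).
Local Notation freq := (@freq R).
Implicit Types f g S : R -> R.

(** The derivative of [phi j], named because it has to be differentiated again. *)
Definition dphi j x :=
  (-1) ^+ (~~ odd j) * freq j * phi (if odd j then j.-1 else j.+1) x.

Lemma dphi_derive j x : is_derive x (1:R) (dphi j) (- freq j ^+ 2 * phi j x).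
Proof.
have H c i (d : R) : is_derive x (1:R) (phi i) d ->
    is_derive x (1:R) (fun y => c * phi i y) (c * d).
  by move=> di; have := @is_deriveZ _ _ _ _ c _ _ _ di; apply.
set c := (-1) ^+ (~~ odd j) * freq j; set j' := if odd j then j.-1 else j.+1.
suff e : c * ((-1) ^+ (~~ odd j') * freq j' * phi (if odd j' then j'.-1 else j'.+1) x) =
    - freq j ^+ 2 * phi j x.
  by rewrite -e; apply: H; exact: phi_derive.
rewrite /c /j' {c j' H}; case: j => [|j].
  have f0 : freq 0 = 0 by rewrite /freq mulr0.
  by rewrite f0 mulr0 !mul0r expr0n oppr0 mul0r.
rewrite /=; have [/= oj|/= oj] := boolP (odd j).
  rewrite oj /= /freq/= uphalf_half oj/= expr0 expr1; ring.
rewrite (negbTE oj) /= /freq/= uphalf_half (negbTE oj)/= expr0 expr1 add0n; ring.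
Qed.

Lemma dphi_periodic j x : dphi j (x + 1) = dphi j x.
Proof. by rewrite /dphi phi_periodic. Qed.

Lemma continuousM_fun f g : continuous f -> continuous g ->
  continuous (fun x => f x * g x).
Proof. by move=> cf cg x; apply: cvgM; [exact: cf|exact: cg]. Qed.

Lemma continuousD_fun f g : continuous f -> continuous g ->
  continuous (fun x => f x + g x).
Proof. by move=> cf cg x; apply: cvgD; [exact: cf|exact: cg]. Qed.

Lemma continuousB_fun f g : continuous f -> continuous g ->
  continuous (fun x => f x - g x).
Proof. by move=> cf cg x; apply: cvgB; [exact: cf|exact: cg]. Qed.

Lemma continuousZ_fun c g : continuous g -> continuous (fun x => c * g x).
Proof. by move=> cg; apply: continuousM_fun => // x; exact: cvg_cst. Qed.

Lemma continuousX_fun f n : continuous f -> continuous (fun x => f x ^+ n).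
Proof.
move=> cf; elim: n => [|n IH]; first by move=> x; exact: cvg_cst.
rewrite (_ : (fun x => _) = fun x => f x * f x ^+ n); first exact: continuousM_fun.
by apply/funext => x; rewrite exprS.
Qed.

Hint Resolve phi_continuous : core.
Hint Resolve continuousM_fun continuousD_fun continuousB_fun : core.
Hint Resolve continuousX_fun continuousZ_fun : core.

Lemma int01_periodic_derive f F : continuous f ->
  (forall x, is_derive x (1:R) F (f x)) -> (forall x, F (x + 1) = F x) ->
  int01 f = 0.
Proof. by move=> cf dF pF; rewrite (int01_FTC cf dF) -[1]add0r pF subrr. Qed.

(** Two eigenfunctions of the second derivative: the Wronskian is periodic and has
    derivative [(freq j ^ 2 - freq i ^ 2) phi i phi j]. *)
Lemma phi_orthogonal i j : freq i ^+ 2 != freq j ^+ 2 ->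
  int01 (fun x => phi i x * phi j x) = 0.
Proof.
move=> fij; apply/eqP.
have : (freq j ^+ 2 - freq i ^+ 2) * int01 (fun x => phi i x * phi j x) = 0.
  have dW (x : R) : is_derive x (1 : R) (fun x => dphi i x * phi j x - phi i x * dphi j x)
      ((freq j ^+ 2 - freq i ^+ 2) * (phi i x * phi j x)).
    have d1 := phi_derive i x; have d2 := phi_derive j x.
    have d3 := dphi_derive i x; have d4 := dphi_derive j x.
    by apply: is_derive_eq; rewrite /GRing.scale/= /dphi; ring.
  rewrite -int01Z; last by auto.
  apply: (int01_periodic_derive _ dW); first by auto.
  by move=> x; rewrite !dphi_periodic !phi_periodic.
by move/eqP; rewrite mulf_eq0 subr_eq0 eq_sym (negbTE fij).
Qed.

Lemma freq_double m : freq m.*2 = 2 * pi * m%:R.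
Proof. by rewrite /freq doubleK. Qed.
Lemma freq_doubleS m : freq m.*2.+1 = 2 * pi * m%:R.
Proof. by rewrite /freq/= uphalf_double. Qed.
Lemma freq_gt0 m : (0 < m)%N -> 0 < 2 * pi * m%:R :> R.
Proof. by move=> m0; rewrite !mulr_gt0 ?pi_gt0 ?ltr0n. Qed.

Lemma phi_derive_even m x :
  is_derive x (1:R) (phi m.*2) (- (2 * pi * m%:R) * phi m.*2.+1 x).
Proof.
have := phi_derive m.*2 x; rewrite freq_double odd_double/= expr1.
by rewrite mulN1r.
Qed.

Lemma phi_derive_odd m x :
  is_derive x (1:R) (phi m.*2.+1) (2 * pi * m%:R * phi m.*2 x).
Proof.
by have := phi_derive m.*2.+1 x; rewrite freq_doubleS/= odd_double/= expr0 mul1r.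
Qed.

(** Inside one frequency, the square of the sine and the product of the cosine with
    the sine are the periodic functions whose derivatives carry the three
    integrals; the sum of the two squares is the constant 2. *)
Lemma phi_orthonormal_block m : (0 < m)%N ->
  [/\ int01 (fun x => phi m.*2 x * phi m.*2.+1 x) = 0,
      int01 (fun x => phi m.*2 x ^+ 2) = 1 &
      int01 (fun x => phi m.*2.+1 x ^+ 2) = 1].
Proof.
move=> m0; have f0 := freq_gt0 m0; set w := 2 * pi * m%:R in f0.
have de x := phi_derive_even m x; have dq x := phi_derive_odd m x.
rewrite -/w in de dq.
have e1 : int01 (fun x => phi m.*2 x * phi m.*2.+1 x) = 0.
  have : (2 * w) * int01 (fun x => phi m.*2 x * phi m.*2.+1 x) = 0.
    rewrite -int01Z; last by auto.
    apply: (@int01_periodic_derive _ (fun x => phi m.*2.+1 x * phi m.*2.+1 x)).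
    - by auto.
    - by move=> x; have d := dq x; apply: is_derive_eq; rewrite /GRing.scale/=; ring.
    - by move=> x; rewrite !phi_periodic.
  by move/eqP; rewrite mulf_eq0 mulf_eq0 pnatr_eq0/= gt_eqF//= => /eqP.
have e2 : int01 (fun x => phi m.*2 x ^+ 2) = int01 (fun x => phi m.*2.+1 x ^+ 2).
  have : w * int01 (fun x => phi m.*2 x ^+ 2 + - 1 * phi m.*2.+1 x ^+ 2) = 0.
    rewrite -int01Z; last by auto.
    apply: (@int01_periodic_derive _ (fun x => phi m.*2 x * phi m.*2.+1 x)).
    - by auto 10.
    - move=> x; have d := dq x; have d' := de x.
      by apply: is_derive_eq; rewrite /GRing.scale/=; ring.
    - by move=> x; rewrite !phi_periodic.
  move/eqP; rewrite mulf_eq0 gt_eqF//= int01D ?int01Z; auto.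
  by rewrite mulN1r subr_eq0 => /eqP.
have e3 : int01 (fun x => phi m.*2 x ^+ 2) + int01 (fun x => phi m.*2.+1 x ^+ 2) = 2.
  rewrite -int01D; auto; rewrite -[RHS]int01_cst; congr int01.
  by apply/funext => x; rewrite phi_energy.
by split => //; move: e3; rewrite e2; lra.
Qed.

Lemma phi_orthonormal i j : (0 < i)%N -> (0 < j)%N ->
  int01 (fun x => phi i x * phi j x) = (i == j)%:R.
Proof.
move=> i0 j0.
have [e|ne] := eqVneq i./2 j./2; last first.
  rewrite phi_orthogonal.
    by case: eqP => // ij; move: ne; rewrite ij eqxx.
  rewrite /freq !exprMn; apply/negP => /eqP.
  have p0 : 2 ^+ 2 * pi ^+ 2 != 0 :> R.
    by rewrite mulf_neq0// expf_neq0// gt_eqF// pi_gt0.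
  by move/(mulfI p0)/eqP; rewrite -!natrX eqr_nat eqn_exp2r// (negbTE ne).
have [m0|m0] := posnP i./2.
  have -> : i = 1%N by case: i i0 m0 {e} => [|[|]].
  have -> : j = 1%N by rewrite m0 in e; case: j j0 e => [|[|]].
  by rewrite eqxx -[RHS]int01_cst; congr int01; apply/funext => x; rewrite mulr1.
have [b1 b2 b3] := phi_orthonormal_block m0.
have b4 : int01 (fun x => phi (i./2).*2.+1 x * phi (i./2).*2 x) = 0.
  by rewrite -[RHS]b1; congr int01; apply/funext => x; rewrite mulrC.
rewrite -(odd_double_half i) -(odd_double_half j) -e.
case: (odd i); case: (odd j); rewrite ?add0n ?add1n ?eqxx.
- by rewrite -[RHS]b3; congr int01; apply/funext => x; rewrite expr2.
- by rewrite b4 gtn_eqF.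
- by rewrite b1 ltn_eqF.
- by rewrite -[RHS]b2; congr int01; apply/funext => x; rewrite expr2.
Qed.

End fourier.


(** * Fourier coefficients and completeness *)

Section coefficients.
Context (R : realType).
Local Notation mu := (@lebesgue_measure R).
Local Notation phi := (@phi R).
Local Notation freq := (@freq R).
Implicit Types f g S : R -> R.

Hint Resolve phi_continuous : core.
Hint Resolve continuousM_fun continuousD_fun continuousB_fun : core.
Hint Resolve continuousX_fun continuousZ_fun continuous_sum : core.

Definition fcoef S j := int01 (fun t => phi j t * S t).

Lemma int01_trig_sqr (N : nat) (a : nat -> R) :
  int01 (fun x => (\sum_(1 <= j < N) a j * phi j x) ^+ 2) =
  \sum_(1 <= j < N) a j ^+ 2.
Proof.
transitivity (int01 (fun x => \sum_(1 <= i < N) \sum_(1 <= j < N)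
    (a i * a j) * (phi i x * phi j x))).
  congr int01; apply/funext => x; rewrite expr2 big_distrl/=.
  apply: eq_bigr => i _; rewrite big_distrr/=; apply: eq_bigr => j _; ring.
rewrite int01_sum; last by auto.
rewrite !big_nat; apply: eq_bigr => i /andP[i0 iN].
rewrite int01_sum; last by auto.
rewrite (bigD1_seq i) ?mem_index_iota ?i0 ?iota_uniq//=.
rewrite int01Z; last by auto.
rewrite phi_orthonormal// eqxx mulr1 -expr2 big_nat_cond big1 ?addr0//.
move=> j /andP[/andP[j0 _] ji]; rewrite int01Z; last by auto.
by rewrite phi_orthonormal// eq_sym (negbTE ji) mulr0.
Qed.

(** Pythagoras; the energy of [S] outside the first frequencies is kept as a
    difference. *)
Lemma int01_trig_error (N : nat) (a : nat -> R) S : continuous S ->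
  int01 (fun x => (\sum_(1 <= j < N) a j * phi j x - S x) ^+ 2) =
  \sum_(1 <= j < N) (a j - fcoef S j) ^+ 2 +
  (int01 (fun x => S x ^+ 2) - \sum_(1 <= j < N) fcoef S j ^+ 2).
Proof.
move=> cS.
have cT : continuous (fun x => \sum_(1 <= j < N) a j * phi j x) by auto.
transitivity (int01 (fun x => (\sum_(1 <= j < N) a j * phi j x) ^+ 2
   + ((-2) * (\sum_(1 <= j < N) a j * (phi j x * S x)) + S x ^+ 2))).
  congr int01; apply/funext => x.
  rewrite (_ : \sum_(1 <= j < N) a j * (phi j x * S x) =
     (\sum_(1 <= j < N) a j * phi j x) * S x); first by ring.
  by rewrite big_distrl/=; apply: eq_bigr => j _; rewrite mulrA.
rewrite int01D; [|by auto|by auto 10].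
rewrite int01D; [|by auto 10|by auto].
rewrite int01Z; last by auto 10.
rewrite int01_trig_sqr int01_sum; last by auto.
rewrite addrA [RHS]addrA [RHS]addrAC; congr (_ + _).
rewrite mulr_sumr -big_split/= -sumrB; apply: eq_bigr => j _.
by rewrite int01Z; [rewrite -/(fcoef S j); ring|auto].
Qed.

Lemma bessel (N : nat) S : continuous S ->
  \sum_(1 <= j < N) fcoef S j ^+ 2 <= int01 (fun x => S x ^+ 2).
Proof.
move=> cS; rewrite -subr_ge0.
have := int01_trig_error N (fcoef S) cS.
rewrite big1 ?add0r; first by move=> <-; apply: int01_ge0 => x; exact: sqr_ge0.
by move=> j _; rewrite subrr expr0n.
Qed.

(** The sine measures the distance on the circle: one of [x - t] and
    [1 - (x - t)] is at most 1/2, and the mean value theorem is applied along the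
    corresponding arc. *)
Lemma periodic_lipschitz S : (forall x, S (x + 1) = S x) ->
  (forall x, derivable S x 1) -> continuous (derive1 S) ->
  exists2 L, 0 <= L & forall x t, 0 <= x <= 1 -> 0 <= t <= 1 ->
    (S x - S t) ^+ 2 <= L ^+ 2 * sin (pi * (x - t)) ^+ 2.
Proof.
move=> pS dS cS'.
have cS : continuous S.
  by move=> x; apply/differentiable_continuous/derivable1_diffP.
have [c _ cmax] : exists2 c, c \in `[0, 2] &
    forall t, t \in `[(0:R), 2] -> `|(derive1 S) t| <= `|(derive1 S) c|.
  apply: EVT_max => //; apply: continuous_subspaceT => x.
  by apply: (@continuous_comp _ _ _ (derive1 S) Num.norm); [exact: cS'|exact: norm_continuous].
set L := `|(derive1 S) c| in cmax.
have lip a b : 0 <= a -> a <= b -> b <= 2 -> `|S b - S a| <= L * (b - a).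
  move=> a0; rewrite le_eqVlt => /predU1P[->|ab] b2; first by rewrite !subrr normr0 mulr0.
  have [|d] := @MVT R S (derive1 S) a b ab _ (continuous_subspaceT cS).
    by move=> y _; rewrite derive1E; apply: DeriveDef.
  rewrite in_itv/= => /andP[ad db] ->.
  have ba : 0 <= b - a by rewrite subr_ge0 ltW.
  rewrite normrM (ger0_norm ba) ler_wpM2r// cmax// in_itv/=.
  by apply/andP; split; lra.
have pi2 := @pi_ge2 R.
have sin_ge (u : R) : 0 <= u -> u <= 1 / 2 -> u <= sin (pi * u).
  move=> u0 u2.
  have h1 : 2 * u <= pi * u by rewrite ler_wpM2r.
  have h2 : pi * u <= pi * (1 / 2) by rewrite ler_wpM2l//; lra.
  by apply: le_trans (@sin_ge_half R (pi * u) _); [lra|apply/andP; split; lra].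
exists L => [|x t]; first exact: normr_ge0.
wlog tx : x t / t <= x.
  move=> H; case: (leP t x) => [/H//|/ltW xt x01 t01].
  rewrite -sqrrN opprB (_ : x - t = - (t - x)); last by ring.
  by rewrite mulrN sinN sqrrN; exact: H.
move=> /andP[x0 x1] /andP[t0 t1].
have L0 : 0 <= L by exact: normr_ge0.
suff [u [u0 Su us]] : exists u, [/\ 0 <= u, `|S x - S t| <= L * u & u <= sin (pi * (x - t))].
  rewrite -exprMn -[leLHS]real_normK ?num_real// ler_sqr ?nnegrE.
  - by rewrite (le_trans Su)// ler_wpM2l.
  - exact: normr_ge0.
  - by rewrite mulr_ge0// (le_trans u0).
have [h|h] := leP (x - t) (1 / 2).
  exists (x - t); split; [by rewrite subr_ge0|apply: lip => //; lra|].
  by apply: sin_ge => //; rewrite subr_ge0.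
exists (1 - (x - t)); split; first lra.
  rewrite distrC -(pS t) (_ : 1 - (x - t) = t + 1 - x); last ring.
  by apply: lip; lra.
rewrite (_ : sin (pi * (x - t)) = sin (pi * (1 - (x - t)))); first by apply: sin_ge; lra.
rewrite (_ : pi * (1 - (x - t)) = - (pi * (x - t)) + pi); last ring.
by rewrite sinDpi sinN opprK.
Qed.

(** The energy of [S] outside its first [n] coefficients. *)
Definition residual S n :=
  int01 (fun x => S x ^+ 2) - \sum_(1 <= j < n.+1) fcoef S j ^+ 2.

Lemma residual_ge0 S n : continuous S -> 0 <= residual S n.
Proof. by move=> cS; rewrite subr_ge0; exact: bessel. Qed.

Lemma residual_nincr S m n : (m <= n)%N -> residual S n <= residual S m.
Proof.
move=> mn; rewrite /residual lerD2l lerN2 [leRHS](@big_cat_nat _ _ _ m.+1)//=.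
by rewrite lerDl sumr_ge0// => j _; exact: sqr_ge0.
Qed.

Lemma fcoef1 j : (0 < j)%N -> fcoef (fun=> 1) j = (j == 1%N)%:R.
Proof.
move=> j0; rewrite -(@phi_orthonormal R j 1)// /fcoef; congr int01.
Qed.

(** Integrating in [t], the square is expanded: the constant term of the kernel
    keeps [S x ^ 2], the cross term gives the partial Fourier sum of [S]. *)
Lemma dirichlet_inner S M x : continuous S ->
  int01 (fun t => (S x - S t) ^+ 2 * \sum_(1 <= j < M.*2.+2) phi j x * phi j t) =
  S x ^+ 2 + ((-2) * (\sum_(1 <= j < M.*2.+2) fcoef S j * (phi j x * S x))
   + \sum_(1 <= j < M.*2.+2) fcoef (fun t => S t ^+ 2) j * phi j x).
Proof.
move=> cS; pose c j := fcoef (fun t => S t ^+ 2) j.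
transitivity (int01 (fun t => \sum_(1 <= j < M.*2.+2)
   (S x ^+ 2 * phi j x * (phi j t * 1) + ((- 2 * S x * phi j x) * (phi j t * S t)
     + phi j x * (phi j t * S t ^+ 2))))).
  congr int01; apply/funext => t; rewrite big_distrr/=.
  by apply: eq_bigr => j _; ring.
have c1 : continuous (fun _ : R => 1 : R) by exact: cst_continuous.
rewrite int01_sum; last by auto 10.
transitivity (\sum_(1 <= j < M.*2.+2) (S x ^+ 2 * phi j x * (j == 1%N)%:R +
    (-2 * (fcoef S j * (phi j x * S x)) + c j * phi j x))).
  apply: eq_big_nat => j /andP[j0 _].
  rewrite int01D; [|by auto|by auto 10]; rewrite int01D; [|by auto|by auto].
  rewrite !int01Z; [|by auto..].
  rewrite -(fcoef1 j0) /c /fcoef; ring.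
rewrite big_split/= big_split/= -mulr_sumr; congr (_ + _).
rewrite big_ltn// eqxx phi1 !mulr1 big_nat_cond big1 ?addr0// => j.
by rewrite andbT => /andP[j1 _]; rewrite gtn_eqF// mulr0.
Qed.

(** Integrating in [x] as well, the partial sum of the squared coefficients comes
    from the cross term, while both squares contribute the full energy. *)
Lemma residual_dirichlet S M : continuous S ->
  int01 (fun x => int01 (fun t => (S x - S t) ^+ 2 *
     \sum_(1 <= j < M.*2.+2) phi j x * phi j t)) = 2 * residual S M.*2.+1.
Proof.
move=> cS; pose c j := fcoef (fun t => S t ^+ 2) j.
transitivity (int01 (fun x => S x ^+ 2 + ((-2) * (\sum_(1 <= j < M.*2.+2) fcoef S j * (phi j x * S x))
   + \sum_(1 <= j < M.*2.+2) c j * phi j x))).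
  by congr int01; apply/funext => x; exact: dirichlet_inner.
rewrite int01D; [|by auto|by auto 10].
rewrite int01D; [|by auto 10|by auto].
rewrite int01Z; last by auto.
rewrite !int01_sum; [|by auto|by auto].
have -> : \sum_(1 <= i < M.*2.+2) int01 (fun t => c i * phi i t) = int01 (fun t => S t ^+ 2).
  rewrite big_ltn// big_nat_cond big1 ?addr0.
    rewrite int01Z ?/c//; rewrite -[X in _ * X]int01_cst.
    rewrite (_ : int01 _ = 1) ?mulr1; first by rewrite /fcoef; congr int01; apply/funext => t; rewrite phi1 mul1r.
    by rewrite int01_cst; exact: int01_cst.
  move=> j; rewrite andbT => /andP[j1 _]; rewrite int01Z//.
  have := fcoef1 (ltnW j1); rewrite gtn_eqF// /fcoef.
  by under eq_fun do rewrite mulr1; move=> ->; rewrite mulr0.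
rewrite (eq_bigr (fun j => fcoef S j ^+ 2)); last first.
  by move=> j _; rewrite int01Z; [rewrite expr2|auto].
rewrite /residual; ring.
Qed.

(** Summing the previous identity over [M < N], the kernels add up to the Fejer
    kernel, whose singularity [(sin (pi (x - t)))^-2] is cancelled by the squared
    increment of [S]. Hence the sum of [N] residuals is bounded, and since they
    decrease, the last one is of order [1 / N]. *)
Lemma parseval S (e : R) : (forall x, S (x + 1) = S x) ->
  (forall x, derivable S x 1) -> continuous (derive1 S) -> 0 < e ->
  exists M0, forall M, (M0 <= M)%N -> residual S M.*2.+1 <= e.
Proof.
move=> pS dS cS' e0.
have cS : continuous S.
  by move=> x; apply/differentiable_continuous/derivable1_diffP.
have [L L0 lip] := periodic_lipschitz pS dS cS'.
pose K M x t : R := \sum_(1 <= j < M.*2.+2) phi j x * phi j t.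
have KE N x t : \sum_(0 <= M < N) K M x t * sin (pi * (x - t)) ^+ 2 =
    sin (N%:R * (pi * (x - t))) ^+ 2.
  rewrite -mulr_suml -fejer_kernel [RHS]mulrC; congr (_ * _).
  apply: eq_bigr => M _; rewrite /K dirichlet_kernel; congr (1 + 2 * _).
  by apply: eq_bigr => m _; congr cos; ring.
have Kle N x t : 0 <= x <= 1 -> 0 <= t <= 1 ->
    \sum_(0 <= M < N) (S x - S t) ^+ 2 * K M x t <= L ^+ 2.
  move=> x01 t01; have {}lip := lip x t x01 t01.
  have := KE N x t; rewrite -mulr_suml -mulr_sumr.
  set F := \sum_(0 <= M < N) _; set s := sin (pi * (x - t)) in lip * => FE.
  have s1 : sin (N%:R * (pi * (x - t))) ^+ 2 <= 1.
    by rewrite -real_normK ?num_real// exprn_ile1// sin_max.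
  (* On the diagonal of the circle the kernel is large but the increment is 0. *)
  have [s0|s0] := eqVneq s 0.
    have /eqP : (S x - S t) ^+ 2 = 0.
      by apply/eqP; rewrite eq_le sqr_ge0 (le_trans lip)// s0 expr0n mulr0.
    by move=> /eqP ->; rewrite mul0r sqr_ge0.
  have F0 : 0 <= F.
    by rewrite -(pmulr_lge0 _ (_ : 0 < s ^+ 2)) ?FE ?sqr_ge0// exprn_even_gt0.
  apply: (@le_trans _ _ (L ^+ 2 * s ^+ 2 * F)); first by rewrite ler_wpM2r.
  by rewrite -mulrA [_ * F]mulrC FE ler_piMr// sqr_ge0.
have sumle N : 2 * \sum_(0 <= M < N) residual S M.*2.+1 <= L ^+ 2.
  rewrite mulr_sumr.
  rewrite (eq_bigr (fun M => int01 (fun x => int01 (fun t =>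
    (S x - S t) ^+ 2 * K M x t)))); last first.
    by move=> M _; rewrite -residual_dirichlet.
  have cG M x : continuous (fun t => (S x - S t) ^+ 2 * K M x t).
    apply: continuousM_fun; last by apply: continuous_sum => j; exact: continuousZ_fun.
    by apply: continuousX_fun; apply: continuousB_fun => //; exact: cst_continuous.
  have cH M : continuous (fun x => int01 (fun t => (S x - S t) ^+ 2 * K M x t)).
    rewrite (_ : (fun x => _) = fun x => S x ^+ 2 +
      ((-2) * (\sum_(1 <= j < M.*2.+2) fcoef S j * (phi j x * S x)) +
       \sum_(1 <= j < M.*2.+2) fcoef (fun t => S t ^+ 2) j * phi j x)); last first.
      by apply/funext => x; exact: dirichlet_inner.
    by auto 10.
  rewrite -int01_sum//.
  rewrite -[leRHS]int01_cst; apply: int01_le.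
  - by apply: continuous_sum => M; exact: cH.
  - exact: cst_continuous.
  move=> x x01; rewrite -int01_sum//.
  rewrite -[leRHS]int01_cst; apply: int01_le => //.
  - by apply: continuous_sum => M; exact: cG.
  - exact: cst_continuous.
  by move=> t t01; exact: Kle.
have res_ge0 M : 0 <= residual S M.*2.+1 by exact: residual_ge0.
have resle M : residual S M.*2.+1 <= L ^+ 2 / M.+1%:R.
  rewrite ler_pdivlMr ?ltr0n//.
  apply: le_trans (sumle M.+1).
  apply: (@le_trans _ _ (\sum_(0 <= i < M.+1) residual S i.*2.+1)); last first.
    by rewrite mulrC ler_peMr// ?ler1n// sumr_ge0.
  rewrite mulr_natr -{1}[M.+1]subn0 -sumr_const_nat.
  apply: ler_sum_nat => i /andP[_ iM]; apply: residual_nincr.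
  by rewrite ltnS leq_double.
exists (Num.truncn (L ^+ 2 / e)) => M hM.
apply: le_trans (resle M) _; rewrite ler_pdivrMr ?ltr0n// mulrC -ler_pdivrMr//.
by apply: ltW; apply: lt_le_trans (truncnS_gt _) _; rewrite ler_nat ltnS.
Qed.

End coefficients.


(** * Smooth signals *)

Section sobolev.
Context (R : realType).
Local Notation mu := (@lebesgue_measure R).
Local Notation phi := (@phi R).
Local Notation freq := (@freq R).
Implicit Types f g S : R -> R.

Hint Resolve phi_continuous : core.
Hint Resolve continuousM_fun continuousD_fun continuousB_fun : core.
Hint Resolve continuousX_fun continuousZ_fun continuous_sum : core.

Definition block_energy S m := fcoef S m.*2 ^+ 2 + fcoef S m.*2.+1 ^+ 2.

(** Integration by parts exchanges the two coefficients of a frequency, up to sign,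
    and multiplies them by that frequency. Only the energy of the pair is
    preserved by the exchange. *)
Lemma block_energy_derive f m : (0 < m)%N -> f 0 = f 1 ->
  (forall x, derivable f x 1) -> continuous (derive1 f) ->
  block_energy (derive1 f) m = (2 * pi * m%:R) ^+ 2 * block_energy f m.
Proof.
move=> m0 f01 df cf'.
have cf : continuous f.
  by move=> x; apply/differentiable_continuous/derivable1_diffP.
have dF x : is_derive x (1:R) f (derive1 f x).
  by rewrite derive1E; exact: DeriveDef.
have perphi j : phi j 1 = phi j 0 by rewrite -[1]add0r phi_periodic.
have parts j (c : R) j' : (forall x, is_derive x (1:R) (phi j) (c * phi j' x)) ->
    fcoef (derive1 f) j = - c * fcoef f j'.
  move=> dphi.
  have : int01 (fun t => phi j t * derive1 f t + c * (phi j' t * f t)) = 0.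
    have dG (x : R) : is_derive x (1:R) (fun t => phi j t * f t)
        (phi j x * derive1 f x + c * (phi j' x * f x)).
      have d1 := dF x; have d2 := dphi x.
      by apply: is_derive_eq; rewrite /GRing.scale/=; ring.
    rewrite (int01_FTC _ dG); first by rewrite perphi f01 subrr.
    by auto.
  rewrite int01D; [|by auto|by auto]; rewrite int01Z; last by auto.
  by rewrite /fcoef; lra.
rewrite /block_energy (parts _ _ _ (phi_derive_even m)) (parts _ _ _ (phi_derive_odd m)).
ring.
Qed.

Lemma block_energy_derive1n k S m i : (0 < m)%N -> Ck_per k S -> (i <= k)%N ->
  block_energy (derive1n i S) m = (2 * pi * m%:R) ^+ (2 * i) * block_energy S m.
Proof.
move=> m0 [pS dS cS bS]; elim: i => [|i IH] ik; first by rewrite muln0 mul1r.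
rewrite derive1nS block_energy_derive//.
- by rewrite IH 1?ltnW// mulnS exprD mulrA.
- by rewrite bS// ltnW.
- by move=> x; exact: dS.
- by rewrite -derive1nS; exact: cS.
Qed.

Lemma Ck_per_continuous k S : Ck_per k S -> continuous S.
Proof. by move=> [_ _ cS _]; exact: (cS 0%N). Qed.

Lemma Ck_per_bessel k S N : (1 <= k)%N -> Ck_per k S ->
  \sum_(1 <= j < N) freq j ^+ (2 * k) * fcoef S j ^+ 2 <=
  int01 (fun x => derive1n k S x ^+ 2).
Proof.
move=> k1 CS; have [pS dS cS bS] := CS.
have nneg j : 0 <= freq j ^+ (2 * k) * fcoef S j ^+ 2.
  by rewrite mulr_ge0 ?sqr_ge0// exprM exprn_ge0// sqr_ge0.
apply: (@le_trans _ _ (\sum_(1 <= j < N.*2.+2) freq j ^+ (2 * k) * fcoef S j ^+ 2)).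
  case: N => [|N]; first by rewrite big_geq// sumr_ge0.
  rewrite [leRHS](@big_cat_nat _ _ _ N.+1)//=; last by rewrite -addnn; lia.
  by rewrite lerDl sumr_ge0.
apply: le_trans (bessel N.*2.+2 (cS k (leqnn k))).
rewrite !sum_pairs; apply: lerD.
  rewrite (_ : freq 1 = 0) ?expr0n; last by rewrite /freq mulr0.
  by rewrite muln_eq0/= eqn0Ngt k1/= mul0r sqr_ge0.
apply: ler_sum_nat => m /andP[m0 _].
rewrite -/(block_energy (derive1n k S) m) (block_energy_derive1n m0 CS)//.
by rewrite freq_double freq_doubleS -mulrDr.
Qed.

(** The Sobolev ball lies in an ellipsoid: Bessel's inequality for the [k]-th
    derivative. *)
Lemma sobolev_bound k r S N : (1 <= k)%N -> sobolev_ball k r S ->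
  \sum_(1 <= j < N) freq j ^+ (2 * k) * fcoef S j ^+ 2 <= r.
Proof.
move=> k1 [CS Sr]; apply: le_trans (Ck_per_bessel N k1 CS) _.
apply: le_trans Sr; rewrite big_nat_recr//= lerDr sumr_ge0// => j _.
by apply: Rintegral_ge0 => x _; exact: sqr_ge0.
Qed.

Lemma freq_ge j : (2 <= j)%N -> j%:R <= freq j.
Proof.
move=> j2; rewrite /freq.
have h : (j <= 2 * 2 * j./2)%N by lia.
apply: (@le_trans _ _ (2 * 2 * (j./2)%:R)); first by rewrite -!natrM ler_nat.
by rewrite ler_wpM2r// ler_wpM2l// pi_ge2.
Qed.

Lemma sobolev_sum_tail k r S n N : (1 <= k)%N -> (1 <= n)%N -> sobolev_ball k r S ->
  \sum_(n.+1 <= j < N) fcoef S j ^+ 2 <= r / n.+1%:R ^+ 2.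
Proof.
move=> k1 n1 SB; rewrite ler_pdivlMr ?exprn_gt0 ?ltr0n//.
apply: le_trans (sobolev_bound N k1 SB).
have nneg j : 0 <= freq j ^+ (2 * k) * fcoef S j ^+ 2.
  by rewrite mulr_ge0 ?sqr_ge0// exprM exprn_ge0// sqr_ge0.
have [nN|Nn] := leqP n.+1 N; last first.
  by rewrite big_geq ?mul0r ?sumr_ge0// ltnW.
rewrite [leRHS](@big_cat_nat _ _ _ n.+1)//=.
rewrite mulr_suml -[leLHS]add0r lerD ?sumr_ge0//.
apply: ler_sum_nat => j /andP[nj _]; rewrite mulrC ler_wpM2r ?sqr_ge0//.
have nf : n.+1%:R <= freq j.
  by apply: le_trans (freq_ge _); rewrite ?ler_nat//; lia.
have f1 : 1 <= freq j by apply: le_trans nf; rewrite ler1n.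
rewrite (le_trans (y := freq j ^+ 2))//; last by rewrite ler_weXn2l//; lia.
by rewrite lerXn2r// ?nnegrE// (le_trans _ f1).
Qed.

(** The coefficients beyond [n] are controlled by the ellipsoid, those beyond an
    arbitrarily large rank by completeness. *)
Lemma sobolev_residual k r S n : (1 <= k)%N -> (1 <= n)%N -> sobolev_ball k r S ->
  residual S n <= r / n.+1%:R ^+ 2.
Proof.
move=> k1 n1 SB; have [CS _] := SB; have [pS dS cS bS] := CS.
apply/ler_addgt0Pr => e e0.
have [M0 hM] := parseval pS (fun x => dS 0%N x k1) (cS 1%N k1) e0.
have := hM _ (leq_maxl M0 n); set M := maxn M0 n => tM.
have nM : (n <= M)%N by exact: leq_maxr.
apply: le_trans (lerD (sobolev_sum_tail M.*2.+2 k1 n1 SB) tM).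
rewrite /residual (@big_cat_nat _ _ _ n.+1 1 M.*2.+2)//=; last by lia.
by lra.
Qed.

End sobolev.


(** * The oracle inequality for one path *)

Section pathwise.
Context (R : realType) (n : nat) (theta xi v : nat -> R) (vs res : R).
Hypothesis n0 : (0 < n)%N.
Implicit Types a g : nat -> R.

Local Notation sn := (Num.sqrt n%:R : R).
Local Notation "'\S_' j E" := (\sum_(1 <= j < n.+1) E)
  (at level 41, j at level 0, E at level 41).

Definition observed j := theta j + xi j / sn.
Definition loss g := \S_j (g j * observed j - theta j) ^+ 2 + res.
Definition bias2 g := \S_j (1 - g j) ^+ 2 * theta j ^+ 2.
Definition sqnorm g := \S_j g j ^+ 2.
Definition mass g := \S_j g j.
(** The value that [loss g] would have if the squared noise coefficients were all
    equal to [vs] and the linear noise vanished. *)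
Definition proxy g := bias2 g + res + vs * sqnorm g / n%:R.
Definition lin_noise a := \S_j a j * xi j.
Definition quad_noise a := \S_j a j * (xi j ^+ 2 - v j).
Definition var_defect a := \S_j a j * (v j - vs).
Definition cost rho sh g :=
  \S_j g j ^+ 2 * observed j ^+ 2
  - 2 * (\S_j g j * (observed j ^+ 2 - sh / n%:R))
  + rho * (sh * sqnorm g / n%:R).

Let nR0 : 0 < n%:R :> R. Proof. by rewrite ltr0n. Qed.
Let sn0 : 0 < sn. Proof. by rewrite sqrtr_gt0. Qed.
Let sn2 : sn ^+ 2 = n%:R. Proof. by rewrite sqr_sqrtr// ltW. Qed.

(** The coefficients of the four noise terms: [cross] and [wsq] occur in the loss,
    [cross2] and [wcost] in the cost. *)
Definition cross g j := g j * (1 - g j) * theta j.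
Definition cross2 g j := (1 - g j) ^+ 2 * theta j.
Definition wsq g j := g j ^+ 2.
Definition wcost g j := g j ^+ 2 - 2 * g j.

Lemma lossE g : loss g = proxy g - 2 * (lin_noise (cross g) / sn)
  + (quad_noise (wsq g) + var_defect (wsq g)) / n%:R.
Proof.
rewrite /loss /proxy /bias2 /sqnorm /lin_noise /quad_noise /var_defect.
rewrite [RHS](_ : _ = \S_j ((1 - g j) ^+ 2 * theta j ^+ 2 + vs * g j ^+ 2 / n%:R
  - 2 * (cross g j * xi j / sn) + (wsq g j * (xi j ^+ 2 - v j) + wsq g j * (v j - vs)) / n%:R) + res).
  congr (_ + _); apply: eq_bigr => j _; rewrite /cross /wsq /observed.
  by move: (sn) sn2 sn0 => s <- s0; field; rewrite gt_eqF.
rewrite !big_split/= sumrN -!mulr_sumr -!mulr_suml -!mulr_sumr big_split/=; ring.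
Qed.

(** The three terms added to the cost do not depend on the weight. With them the
    cost is again the proxy risk plus noise, and the linear noise has the
    coefficients [(1 - g j) ^ 2 theta j], which the bias controls. *)
Lemma costE rho sh g :
  cost rho sh g + \S_j theta j ^+ 2 + 2 * (lin_noise theta / sn) + res =
  proxy g + 2 * (lin_noise (cross2 g) / sn)
  + (quad_noise (wcost g) + var_defect (wcost g)) / n%:R
  - 2 * (vs - sh) * mass g / n%:R + rho * (sh * sqnorm g / n%:R).
Proof.
rewrite /cost /proxy /bias2 /lin_noise /quad_noise /var_defect /mass.
set P := rho * _.
rewrite [RHS](_ : _ = \S_j ((1 - g j) ^+ 2 * theta j ^+ 2 + vs * g j ^+ 2 / n%:R
  + 2 * (cross2 g j * xi j / sn) + (wcost g j * (xi j ^+ 2 - v j) + wcost g j * (v j - vs)) / n%:R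
  - 2 * (vs - sh) * g j / n%:R) + res + P); last first.
  rewrite !big_split/= sumrN -!mulr_sumr -!mulr_suml -!mulr_sumr big_split/= /sqnorm; ring.
rewrite [LHS](_ : _ = \S_j (g j ^+ 2 * observed j ^+ 2 - 2 * (g j * (observed j ^+ 2 - sh / n%:R))
  + theta j ^+ 2 + 2 * (theta j * xi j / sn)) + res + P); last first.
  rewrite !big_split/= sumrN -!mulr_sumr -!mulr_suml; ring.
congr (_ + _ + _); apply: eq_bigr => j _; rewrite /cross2 /wcost /observed.
by move: (sn) sn2 sn0 => s <- s0; field; rewrite gt_eqF.
Qed.

(** The squared noises divided by what they are compared with. The summands
    [n^-1] and [1] keep the quotients finite when the bias or the weight vanishes;
    in the risk they cost only terms of order [n^-1]. *)
Definition noise_sq g :=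
  (lin_noise (cross g) ^+ 2 + lin_noise (cross2 g) ^+ 2) / (bias2 g + n%:R^-1)
  + (quad_noise (wsq g) ^+ 2 + quad_noise (wcost g) ^+ 2) / (sqnorm g + 1).

Lemma bias2_ge0 g : 0 <= bias2 g.
Proof. by apply: sumr_ge0 => j _; rewrite mulr_ge0 ?sqr_ge0. Qed.

Lemma sqnorm_ge0 g : 0 <= sqnorm g.
Proof. by apply: sumr_ge0 => j _; rewrite sqr_ge0. Qed.

Lemma amgm (e c x : R) : 0 < e -> 0 < c -> 2 * `|x| <= e * c + x ^+ 2 / (e * c).
Proof.
move=> e0 c0; have ec0 : 0 < e * c by rewrite mulr_gt0.
rewrite -subr_ge0 -(pmulr_rge0 _ ec0).
have : 0 <= (e * c - `|x|) ^+ 2 by exact: sqr_ge0.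
congr (0 <= _); rewrite -(real_normK (num_real x)); field.
by rewrite !gt_eqF.
Qed.

(** Each noise is split by [2 |x| <= e c + x ^ 2 / (e c)], where [c] is a part of the
    proxy risk: a small fraction of the proxy risk absorbs the random weight, and
    what remains is a squared noise of order [n^-1]. *)
Lemma noise_bound (eta L kappa Z : R) g a b : 0 < eta -> 0 <= res -> 0 < kappa ->
  kappa^-1 <= vs -> `|var_defect b| <= L -> noise_sq g <= Z ->
  lin_noise a ^+ 2 <= lin_noise (cross g) ^+ 2 + lin_noise (cross2 g) ^+ 2 ->
  quad_noise b ^+ 2 <= quad_noise (wsq g) ^+ 2 + quad_noise (wcost g) ^+ 2 ->
  2 * `|lin_noise a / sn| + `|quad_noise b + var_defect b| / n%:R <=
  eta * (1 + kappa) * proxy g + (L + 2 * eta + Z / eta) / n%:R.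
Proof.
move=> eta0 res0 kappa0 kvs dL zZ la qb.
have b0 := bias2_ge0 g; have V0 := sqnorm_ge0 g.
have bn0 : 0 < bias2 g + n%:R^-1 by rewrite ltr_wpDl// invr_gt0.
have V10 : 0 < sqnorm g + 1 by rewrite ltr_wpDl.
set lam := lin_noise a; set q := quad_noise b.
have h1 := amgm (lam / sn) eta0 bn0.
have h2 := amgm q eta0 V10.
have vs0 : 0 < vs by apply: lt_le_trans kvs; rewrite invr_gt0.
have h3 : sqnorm g / n%:R <= kappa * proxy g.
  apply: (@le_trans _ _ (kappa * (vs * sqnorm g / n%:R))).
    have : 1 <= kappa * vs by rewrite -ler_pdivrMl// mulr1.
    rewrite -!mulrA mulrA => kv; rewrite ler_peMl//.
    by rewrite divr_ge0.
  by rewrite ler_pM2l// lerDr addr_ge0.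
have h4 : bias2 g <= proxy g.
  by rewrite /proxy -addrA lerDl addr_ge0// divr_ge0// mulr_ge0// (ltW vs0).
have h5 : (lam / sn) ^+ 2 / (eta * (bias2 g + n%:R^-1)) + q ^+ 2 / (eta * (sqnorm g + 1)) / n%:R
   <= Z / eta / n%:R.
  rewrite (_ : _ + _ = (lam ^+ 2 / (bias2 g + n%:R^-1) + q ^+ 2 / (sqnorm g + 1)) / eta / n%:R).
    rewrite ler_pM2r ?invr_gt0// ler_pM2r ?invr_gt0//; apply: le_trans zZ.
    by apply: lerD; rewrite ler_pM2r ?invr_gt0.
  rewrite expr_div_n sn2.
  move: (bias2 g + _) (sqnorm g + 1) bn0 V10 => c d c0 d0.
  by field; rewrite !gt_eqF.
have h6 : `|q + var_defect b| <= `|q| + L by apply: le_trans (ler_normD _ _) _; rewrite lerD2l.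
have h7 : `|q + var_defect b| / n%:R <= (eta * (sqnorm g + 1) + q ^+ 2 / (eta * (sqnorm g + 1)) + L) / n%:R.
  rewrite ler_pM2r ?invr_gt0//; apply: le_trans h6 _; rewrite lerD2r.
  by apply: le_trans h2; rewrite mulr_natl mulr2n lerDl.
apply: le_trans (lerD h1 h7) _.
have h8 : eta * (bias2 g + sqnorm g / n%:R) <= eta * ((1 + kappa) * proxy g).
  by rewrite ler_pM2l// mulrDl mul1r lerD.
move: h5 h8; move: (_ / (eta * (bias2 g + _))) (_ / (eta * (sqnorm g + 1))) => A B.
by move: (proxy g) n%:R^-1 (Z / eta) => P i W; lra.
Qed.

Lemma lin_noise_cross g : lin_noise (cross g) ^+ 2 <= lin_noise (cross g) ^+ 2 + lin_noise (cross2 g) ^+ 2.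
Proof. by rewrite lerDl sqr_ge0. Qed.

(** Compare [g] with [g0] through the chain loss of [g], proxy risk of [g], cost of
    [g], cost of [g0], proxy risk of [g0]. The random variance estimate enters the
    cost multiplied by the mass of the weight, so a crude bound [G] of the mass is
    enough; the penalty of [g] is nonnegative and is dropped. *)
Lemma oracle_pathwise (eta L kappa Z G X rho sh : R) g g0 :
  0 < eta -> 0 <= res -> 0 < kappa -> kappa^-1 <= vs ->
  eta * (1 + kappa) < 1 -> 0 <= rho -> 0 <= sh -> `|sh - vs| <= X ->
  (forall h, h = g \/ h = g0 -> [/\ `|var_defect (wsq h)| <= L,
     `|var_defect (wcost h)| <= L, noise_sq h <= Z & 0 <= mass h <= G]) ->
  cost rho sh g <= cost rho sh g0 ->
  (1 - eta * (1 + kappa)) * loss g <= (1 + eta * (1 + kappa)) *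
   ((1 + eta * (1 + kappa)) * proxy g0 + 3 * ((L + 2 * eta + Z / eta) / n%:R)
    + 4 * (X * G / n%:R) + rho * ((vs + X) * sqnorm g0 / n%:R)).
Proof.
move=> eta0 res0 kappa0 kvs; set u := eta * (1 + kappa) => u1 rho0 sh0 shX hg cg.
have vs0 : 0 < vs by apply: lt_le_trans kvs; rewrite invr_gt0.
have u0 : 0 < u by rewrite mulr_gt0// addr_gt0.
set Y := (L + _ + _) / _.
have [gL gL' gZ /andP[gm0 gG]] := hg g (or_introl erefl).
have [hL hL' hZ /andP[hm0 hG]] := hg g0 (or_intror erefl).
have b2 h : lin_noise (cross2 h) ^+ 2 <= lin_noise (cross h) ^+ 2 + lin_noise (cross2 h) ^+ 2.
  by rewrite lerDr sqr_ge0.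
have q1 h : quad_noise (wsq h) ^+ 2 <= quad_noise (wsq h) ^+ 2 + quad_noise (wcost h) ^+ 2.
  by rewrite lerDl sqr_ge0.
have q2 h : quad_noise (wcost h) ^+ 2 <= quad_noise (wsq h) ^+ 2 + quad_noise (wcost h) ^+ 2.
  by rewrite lerDr sqr_ge0.
have n1 := noise_bound eta0 res0 kappa0 kvs gL gZ (lin_noise_cross g) (q1 g).
have n2 := noise_bound eta0 res0 kappa0 kvs gL' gZ (b2 g) (q2 g).
have n3 := noise_bound eta0 res0 kappa0 kvs hL' hZ (b2 g0) (q2 g0).
rewrite -/u -/Y in n1 n2 n3.
have X0 : 0 <= X by apply: le_trans shX.
have crossm h : 0 <= mass h -> mass h <= G ->
    `|2 * (vs - sh) * mass h / n%:R| <= 2 * (X * G / n%:R).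
  move=> h0 hG1; rewrite !normrM normfV (ger0_norm h0) distrC normr_nat (gtr0_norm nR0).
  rewrite -!mulrA ler_pM2l// !mulrA ler_pM2r ?invr_gt0//.
  by apply: ler_pM.
have m1 := crossm g gm0 gG; have m2 := crossm g0 hm0 hG.
have p1 : 0 <= rho * (sh * sqnorm g / n%:R).
  by rewrite mulr_ge0// divr_ge0// mulr_ge0// sqnorm_ge0.
have p2 : rho * (sh * sqnorm g0 / n%:R) <= rho * ((vs + X) * sqnorm g0 / n%:R).
  rewrite ler_wpM2l// ler_pM2r ?invr_gt0// ler_wpM2r ?sqnorm_ge0//.
  by move: (ler_norm (sh - vs)) => ?; lra.
have Y0 : 0 <= Y.
  have L0 : 0 <= L by apply: le_trans gL.
  have Z0 : 0 <= Z.
    have d1 : 0 <= bias2 g + n%:R^-1 by rewrite addr_ge0 ?bias2_ge0// invr_ge0 ltW.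
    have d2 : 0 <= sqnorm g + 1 by rewrite addr_ge0 ?sqnorm_ge0.
    apply: le_trans gZ; apply: addr_ge0; apply: divr_ge0 => //;
      by rewrite addr_ge0 ?sqr_ge0.
  rewrite divr_ge0 ?(ltW nR0)// !addr_ge0//; first by rewrite mulr_ge0// ltW.
  by rewrite divr_ge0// ltW.
have absn (a b : R) : [/\ - (2 * `|a| + `|b| / n%:R) <= 2 * a + b / n%:R,
    2 * a + b / n%:R <= 2 * `|a| + `|b| / n%:R &
    - 2 * a + b / n%:R <= 2 * `|a| + `|b| / n%:R].
  have := ler_norm a; have := ler_norm (- a); rewrite normrN => a1 a2.
  have b1 : b / n%:R <= `|b| / n%:R by rewrite ler_pM2r ?invr_gt0// ler_norm.
  have b2' : - b / n%:R <= `|b| / n%:R by rewrite ler_pM2r ?invr_gt0// -normrN ler_norm.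
  by split; lra.
set D := (1 + u) * proxy g0 + 2 * Y + 4 * (X * G / n%:R) +
  rho * ((vs + X) * sqnorm g0 / n%:R).
have s1 : loss g <= (1 + u) * proxy g + Y.
  rewrite lossE; have [_ _] := absn (lin_noise (cross g) / sn)
    (quad_noise (wsq g) + var_defect (wsq g)).
  by move: n1; set l := _ / sn; lra.
have s2 : (1 - u) * proxy g <= D.
  have c1 := costE rho sh g; have c2 := costE rho sh g0.
  have [a1 _ _] := absn (lin_noise (cross2 g) / sn)
    (quad_noise (wcost g) + var_defect (wcost g)).
  have [_ a2 _] := absn (lin_noise (cross2 g0) / sn)
    (quad_noise (wcost g0) + var_defect (wcost g0)).
  have t1 := le_trans (ler_norm _) m1.
  have t2 : - (2 * (vs - sh) * mass g0 / n%:R) <= 2 * (X * G / n%:R).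
    by apply: le_trans m2; rewrite -normrN ler_norm.
  by rewrite /D; lra.
apply: (@le_trans _ _ ((1 - u) * ((1 + u) * proxy g + Y))).
  by rewrite ler_pM2l// subr_gt0.
apply: (@le_trans _ _ ((1 + u) * (D + Y))).
  have : (1 + u) * ((1 - u) * proxy g) <= (1 + u) * D by rewrite ler_wpM2l//; lra.
  have : 0 <= u * Y by rewrite mulr_ge0// ltW.
  by lra.
by rewrite ler_wpM2l//; rewrite /D; lra.
Qed.

End pathwise.


(** * The variance estimator *)

Section variance_estimator.
Context (R : realType) (n : nat) (theta xi v : nat -> R) (vs : R).
Hypothesis n0 : (0 < n)%N.
Local Notation sn := (Num.sqrt n%:R : R).
Local Notation m := (Num.truncn sn).

Definition high (j : nat) : R := (m < j)%N%:R.

Lemma truncn_sqrt_le : (m <= n)%N.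
Proof.
have mle : m%:R <= sn by rewrite truncn_le sqrtr_ge0.
rewrite -(ler_nat R) (le_trans mle)//.
by rewrite -ler_sqr ?nnegrE// sqr_sqrtr// -natrX ler_nat leq_pmulr.
Qed.

Lemma sum_high (F : nat -> R) :
  \sum_(m.+1 <= j < n.+1) F j = \sum_(1 <= j < n.+1) high j * F j.
Proof.
rewrite [RHS](@big_cat_nat _ _ _ m.+1)//= ?ltnS ?truncn_sqrt_le//.
have -> : \sum_(1 <= j < m.+1) high j * F j = 0.
  rewrite big_nat_cond big1// => j /andP[/andP[_ jm] _].
  by rewrite /high ltnNge -ltnS jm/= mul0r.
by rewrite add0r; apply: eq_big_nat => j /andP[mj _]; rewrite /high mj mul1r.
Qed.

(** The first [m] frequencies are missing from the estimator, with [m] at most the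
    square root of [n]; this and the fluctuations are of order [n^-1/2], and the
    remaining error is the energy of the signal at high frequencies. *)
Lemma variance_estimator_error (L : R) : 0 <= vs -> `|var_defect n v vs high| <= L ->
  `|\sum_(m.+1 <= j < n.+1) observed n theta xi j ^+ 2 - vs| <=
  \sum_(m.+1 <= j < n.+1) theta j ^+ 2
  + (2 + lin_noise n xi (fun j => high j * theta j) ^+ 2
       + quad_noise n xi v high ^+ 2 / n%:R) / sn
  + (L + vs * sn) / n%:R.
Proof.
move=> vs0 dL.
have nR0 : 0 < n%:R :> R by rewrite ltr0n.
have sn0 : 0 < sn by rewrite sqrtr_gt0.
have sn2 : sn ^+ 2 = n%:R by rewrite sqr_sqrtr// ltW.
set A := lin_noise _ _ _; set B := quad_noise _ _ _ _.
set C := var_defect _ _ _ _ in dL *.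
have -> : \sum_(m.+1 <= j < n.+1) observed n theta xi j ^+ 2 - vs =
  \sum_(m.+1 <= j < n.+1) theta j ^+ 2 + 2 * (A / sn) + (B + C) / n%:R - vs * m%:R / n%:R.
  have -> : vs * m%:R / n%:R = vs - vs * (\sum_(1 <= j < n.+1) high j) / n%:R.
    rewrite (eq_bigr (fun j => high j * 1)); last by move=> j _; rewrite mulr1.
    rewrite -sum_high sumr_const_nat subSS natrB ?truncn_sqrt_le//.
    by field; rewrite gt_eqF.
  rewrite !sum_high /A /B /C /lin_noise /quad_noise /var_defect.
  rewrite (_ : \sum_(1 <= j < n.+1) high j * observed n theta xi j ^+ 2 =
    \sum_(1 <= j < n.+1) (high j * theta j ^+ 2 + 2 * (high j * theta j * xi j / sn) +
     (high j * (xi j ^+ 2 - v j) + high j * (v j - vs)) / n%:R + vs * high j / n%:R)); last first.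
    apply: eq_bigr => j _; rewrite /observed; move: (high j) => h.
    by move: (sn) sn2 sn0 => s <- s0; field; rewrite gt_eqF.
  rewrite !big_split/= -!mulr_sumr -!mulr_suml -!mulr_sumr big_split/=; ring.
have mle : m%:R <= sn by rewrite truncn_le ltW.
have T0 : 0 <= \sum_(m.+1 <= j < n.+1) theta j ^+ 2 by apply: sumr_ge0 => j _; exact: sqr_ge0.
have hA : `|2 * (A / sn)| <= (1 + A ^+ 2) / sn.
  rewrite !normrM normfV normr_nat (gtr0_norm sn0) mulrA ler_pM2r ?invr_gt0//.
  have := sqr_ge0 (`|A| - 1); rewrite sqrrB real_normK ?num_real//; lra.
have hB : `|B / n%:R| <= (1 + B ^+ 2 / n%:R) / sn.
  rewrite normrM normfV (gtr0_norm nR0) -{1}sn2 expr2 invfM mulrA ler_pM2r ?invr_gt0//.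
  have := sqr_ge0 (`|B| / sn - 1).
  have -> : B ^+ 2 / n%:R = (`|B| / sn) ^+ 2 by rewrite expr_div_n sn2 real_normK ?num_real.
  move: (`|B| / sn) (divr_ge0 (normr_ge0 B) (ltW sn0)) => z z0; rewrite sqrrB; lra.
have hC : `|C / n%:R| <= L / n%:R.
  by rewrite normrM normfV (gtr0_norm nR0) ler_pM2r ?invr_gt0.
have hm : `|vs * m%:R / n%:R| <= vs * sn / n%:R.
  rewrite ger0_norm; last by rewrite divr_ge0 ?mulr_ge0// ltW.
  by rewrite ler_pM2r ?invr_gt0// ler_wpM2l.
apply: le_trans (ler_normB _ _) _; rewrite [(B + C) / _]mulrDl.
apply: le_trans (lerD (ler_normD _ _) hm) _.
apply: le_trans (lerD (lerD (ler_normD _ _) (ler_normD _ _)) (lexx _)) _.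
rewrite (ger0_norm T0).
move: hA hB hC; set a := `|2 * _|; set b := `|B / _|; set c := `|C / _|.
move: (B ^+ 2 / n%:R) (A ^+ 2) (_^-1) => x y i; move: (n%:R^-1) => k; lra.
Qed.

End variance_estimator.

(** * Bounded means *)

Section expectation.
Context d (T : measurableType d) (R : realType) (P : probability T R).
Implicit Types (f g : T -> R) (c : R).

(** Bundling measurability and sign with the bound on the integral makes the
    bound stable under sums and products by nonnegative constants. *)
Definition mean_le f c :=
  [/\ measurable_fun setT f, forall w, 0 <= f w &
      (\int[P]_w (f w)%:E <= c%:E)%E].

Lemma mean_le_cst c : 0 <= c -> mean_le (fun=> c) c.
Proof.
move=> c0; split => //.
by rewrite integral_cst//= probability_setT mule1.
Qed.

Lemma mean_leD f g a b : mean_le f a -> mean_le g b ->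
  mean_le (fun w => f w + g w) (a + b).
Proof.
move=> [mf f0 fa] [mg g0 gb]; split.
- exact: measurable_funD.
- by move=> w; rewrite addr_ge0.
- under eq_integral do rewrite EFinD.
  rewrite ge0_integralD//; first by rewrite EFinD leeD.
  + by move=> w _; rewrite lee_fin.
  + exact/measurable_EFinP.
  + by move=> w _; rewrite lee_fin.
  + exact/measurable_EFinP.
Qed.

Lemma mean_leZ f c a : 0 <= c -> mean_le f a -> mean_le (fun w => c * f w) (c * a).
Proof.
move=> c0 [mf f0 fa]; split.
- exact: measurable_funM (measurable_cst _) mf.
- by move=> w; rewrite mulr_ge0.
- under eq_integral do rewrite EFinM.
  rewrite ge0_integralZl//.
  + by rewrite EFinM lee_wpmul2l.
  + exact/measurable_EFinP.
  + by move=> w _; rewrite lee_fin.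
Qed.

Lemma mean_le_trans f a b : a <= b -> mean_le f a -> mean_le f b.
Proof. by move=> ab [? ? fa]; split => //; rewrite (le_trans fa)// lee_fin. Qed.

Lemma mean_le_sum (I : Type) (s : seq I) (F : I -> T -> R) (a : I -> R) :
  (forall i, mean_le (F i) (a i)) ->
  mean_le (fun w => \sum_(i <- s) F i w) (\sum_(i <- s) a i).
Proof.
move=> Fa; elim: s => [|i s IH].
  rewrite big_nil (_ : (fun _ => _) = fun=> 0); first exact: mean_le_cst.
  by apply/funext => w; rewrite big_nil.
rewrite big_cons (_ : (fun _ => _) = fun w => F i w + \sum_(j <- s) F j w).
  exact: mean_leD.
by apply/funext => w; rewrite big_cons.
Qed.

Lemma mean_le_ae f g c : (forall w, 0 <= f w) -> measurable_fun setT f ->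
  {ae P, forall w, f w <= g w} -> mean_le g c -> (\int[P]_w (f w)%:E <= c%:E)%E.
Proof.
move=> f0 mf fg [mg g0 gc]; apply: le_trans gc.
apply: ae_ge0_le_integral => //.
- by move=> w _; rewrite lee_fin.
- exact/measurable_EFinP.
- by move=> w _; rewrite lee_fin.
- exact/measurable_EFinP.
by apply: filterS fg => w fgw _; rewrite lee_fin.
Qed.

(** A preimage is the finite union of its traces on the pieces where the selected
    value is fixed. This makes the loss of the data-driven weight measurable. *)
Lemma measurable_select (I : finType) (C : Type) (gam : T -> C) (val : I -> C)
    (F : C -> T -> R) :
  (forall i, measurable [set w | gam w = val i]) ->
  (forall w, exists i, gam w = val i) ->
  (forall i, measurable_fun setT (F (val i))) ->
  measurable_fun setT (fun w => F (gam w) w).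
Proof.
move=> mg ex mF _ B mB; rewrite setTI.
rewrite (_ : _ @^-1` B = \bigcup_(i in [set: I])
    ([set w | gam w = val i] `&` (F (val i) @^-1` B))); last first.
  apply/seteqP; split => [w /= Bw|w [i _ [/= e]]]; last by rewrite e.
  by have [i e] := ex w; exists i => //; split => //=; rewrite -e.
apply: fin_bigcup_measurable => // i _; apply: measurableI => //.
by have := mF i measurableT _ mB; rewrite setTI.
Qed.

End expectation.


(** * The oracle inequality in mean *)

Section oracle.
Context (R : realType) d (T : measurableType d) (P : probability T R).
Context (n : nat) (xi : nat -> T -> R) (v theta : nat -> R) (vs res s L : R).
Local Notation sn := (Num.sqrt n%:R : R).
Local Notation m := (Num.truncn sn).
Hypothesis n0 : (0 < n)%N.
Hypothesis mxi : forall j, measurable_fun setT (xi j).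
Hypothesis s0 : 0 <= s.
Hypothesis lin_mean : forall a,
  mean_le P (fun w => lin_noise n (xi ^~ w) a ^+ 2) (s * sqnorm n a).
Hypothesis defect_le : forall x, (forall j, `|x j| <= 1) -> `|var_defect n v vs x| <= L.
Hypothesis quad_mean : forall x,
  mean_le P (fun w => quad_noise n (xi ^~ w) v x ^+ 2) (L * sqnorm n x).

Let nR0 : 0 < n%:R :> R. Proof. by rewrite ltr0n. Qed.
Let sn0 : 0 < sn. Proof. by rewrite sqrtr_gt0. Qed.
Lemma defect_ge0 : 0 <= L.
Proof.
by apply: le_trans (@defect_le (fun=> 0) _) => // j; rewrite normr0.
Qed.
Let L0 := defect_ge0.

Lemma mean_le_div f c a : 0 < c -> mean_le P f a -> mean_le P (fun w => f w / c) (a / c).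
Proof.
move=> c0 fa; rewrite (_ : (fun _ => _) = fun w => c^-1 * f w); last first.
  by apply/funext => w; rewrite mulrC.
by rewrite [_ / _]mulrC; apply: mean_leZ => //; rewrite invr_ge0 ltW.
Qed.

(** The coefficients of the linear noises have squared norm at most the bias, those
    of the quadratic noises at most four times the squared norm of the weight. *)
Lemma noise_sq_mean g : (forall j, 0 <= g j <= 1) ->
  mean_le P (fun w => noise_sq n theta (xi ^~ w) v g) (2 * s + 5 * L).
Proof.
move=> g01; have b0 := bias2_ge0 n theta g; have V0 := sqnorm_ge0 n g.
have bn0 : 0 < bias2 n theta g + n%:R^-1 by rewrite ltr_wpDl// invr_gt0.
have V10 : 0 < sqnorm n g + 1 by rewrite ltr_wpDl.
have lin a : sqnorm n a <= bias2 n theta g ->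
    mean_le P (fun w => lin_noise n (xi ^~ w) a ^+ 2) (s * (bias2 n theta g + n%:R^-1)).
  move=> ab; apply: mean_le_trans (lin_mean a); rewrite ler_wpM2l//.
  by rewrite (le_trans ab)// lerDl invr_ge0 ltW.
have quad a c : sqnorm n a <= c * sqnorm n g -> 0 <= c ->
    mean_le P (fun w => quad_noise n (xi ^~ w) v a ^+ 2) (c * L * (sqnorm n g + 1)).
  move=> ab c0; apply: mean_le_trans (quad_mean a).
  rewrite mulrAC [_ * L]mulrC ler_wpM2l// (le_trans ab)// ler_wpM2l//.
  by rewrite lerDl.
have h1 : sqnorm n (cross theta g) <= bias2 n theta g.
  apply: ler_sum => j _; rewrite /cross !exprMn; have /andP[gj0 gj1] := g01 j.
  by rewrite -mulrA; apply: ler_piMl; [rewrite mulr_ge0 ?sqr_ge0|exact: exprn_ile1].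
have h2 : sqnorm n (cross2 theta g) <= bias2 n theta g.
  apply: ler_sum => j _; rewrite /cross2 !exprMn; have /andP[gj0 gj1] := g01 j.
  rewrite ler_wpM2r ?sqr_ge0//; apply: ler_piMl; first exact: sqr_ge0.
  by apply: exprn_ile1; lra.
have h3 : sqnorm n (wsq g) <= 1 * sqnorm n g.
  rewrite mul1r; apply: ler_sum => j _; rewrite /wsq; have /andP[gj0 gj1] := g01 j.
  by rewrite [leLHS]expr2; apply: ler_piMl; [exact: sqr_ge0|exact: exprn_ile1].
have h4 : sqnorm n (wcost g) <= 4 * sqnorm n g.
  rewrite mulr_sumr; apply: ler_sum => j _; rewrite /wcost; have /andP[gj0 gj1] := g01 j.
  rewrite (_ : _ - _ = g j * (g j - 2)); last by ring.
  rewrite exprMn [leRHS]mulrC ler_wpM2l ?sqr_ge0//.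
  have := sqr_ge0 (2 - g j); nra.
have := mean_leD (mean_le_div bn0 (mean_leD (lin _ h1) (lin _ h2)))
  (mean_le_div V10 (mean_leD (quad _ _ h3 ler01) (quad _ _ h4 (ler0n _ 4)))).
rewrite -!mulrDl mulfK ?gt_eqF// mulfK ?gt_eqF//.
apply: mean_le_trans; lra.
Qed.

Let Theta := \sum_(m.+1 <= j < n.+1) theta j ^+ 2.
Definition variance_error :=
  Theta + (2 + s * Theta + L) / sn + (L + vs * sn) / n%:R.

Let Xerr w := Theta
  + (2 + lin_noise n (xi ^~ w) (fun j => high R n j * theta j) ^+ 2
       + quad_noise n (xi ^~ w) v (high R n) ^+ 2 / n%:R) / sn
  + (L + vs * sn) / n%:R.

Lemma variance_error_mean : 0 <= vs -> mean_le P Xerr variance_error.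
Proof.
move=> vs0.
have T0 : 0 <= Theta by apply: sumr_ge0 => j _; exact: sqr_ge0.
have high2 j : high R n j ^+ 2 = high R n j by rewrite /high; case: ltnP; rewrite ?expr1n ?expr0n.
apply: mean_leD; last first.
  by apply: mean_le_cst; rewrite divr_ge0// ?addr_ge0// ?mulr_ge0// ltW.
apply: mean_leD; first exact: mean_le_cst.
apply: mean_le_div => //; apply: mean_leD; first apply: mean_leD.
- exact: mean_le_cst.
- apply: mean_le_trans (lin_mean _); rewrite ler_wpM2l//.
  rewrite /Theta sum_high// /sqnorm; apply: ler_sum => j _.
  by rewrite exprMn high2.
- have nn0 : n%:R != 0 :> R by rewrite gt_eqF.
  rewrite -[X in mean_le _ _ X](mulfK nn0).
  apply: mean_le_div => //; apply: mean_le_trans (quad_mean _).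
  rewrite ler_wpM2l//; apply: (@le_trans _ _ (\sum_(1 <= j < n.+1) 1)).
    by apply: ler_sum => j _; rewrite high2 /high lern1 leq_b1.
  by rewrite sumr_const_nat subSS subn0.
Qed.

Context (I : finType) (gam : I -> nat -> R) (ghat : T -> nat -> R) (i0 : I).
Context (G kappa rho eta : R).
Hypothesis vs_gt : kappa^-1 <= vs.
Hypothesis kappa0 : 0 < kappa.
Hypothesis eta0 : 0 < eta.
Hypothesis rho0 : 0 <= rho.
Hypothesis res0 : 0 <= res.
Local Notation u := (eta * (1 + kappa)).
Hypothesis u1 : u < 1.
Hypothesis gam01 : forall i j, 0 <= gam i j <= 1.
Hypothesis gamG : forall i, mass n (gam i) <= G.
Hypothesis ghat_range : forall w, exists i, ghat w = gam i.
Hypothesis ghat_meas : forall i, measurable [set w | ghat w = gam i].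
Let shat w := \sum_(m.+1 <= j < n.+1) observed n theta (xi ^~ w) j ^+ 2.
Hypothesis ghat_min : {ae P, forall w,
  cost n theta (xi ^~ w) rho (shat w) (ghat w) <=
  cost n theta (xi ^~ w) rho (shat w) (gam i0)}.

(** The noise at the random weight is bounded by the sum of the noises over the
    finite family, which costs the factor [#|I|] in a term of order [n^-1]. *)
Lemma oracle_mean :
  (\int[P]_w (loss n theta (xi ^~ w) res (ghat w))%:E <=
   ((1 - u)^-1 * ((1 + u) * ((1 + u) * proxy n theta vs res (gam i0)
   + 3 * ((L + 2 * eta + (2 * s + 5 * L) *+ #|I| / eta) / n%:R)
   + 4 * (variance_error * G / n%:R)
   + rho * ((vs + variance_error) * sqnorm n (gam i0) / n%:R))))%:E)%E.
Proof.
have vs0 : 0 < vs by apply: lt_le_trans vs_gt; rewrite invr_gt0.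
have u0 : 0 < u by rewrite mulr_gt0// addr_gt0.
have G0 : 0 <= G.
  by apply: le_trans (gamG i0); apply: sumr_ge0 => j _; have /andP[] := gam01 i0 j.
pose Z w := \sum_(i : I) noise_sq n theta (xi ^~ w) v (gam i).
have Zm : mean_le P Z ((2 * s + 5 * L) *+ #|I|).
  rewrite -sumr_const; apply: mean_le_sum => i.
  exact: noise_sq_mean.
have V0 := sqnorm_ge0 n (gam i0).
have Xm := variance_error_mean (ltW vs0).
apply: (@mean_le_ae _ _ _ _ _ (fun w => (1 - u)^-1 * ((1 + u) * ((1 + u) * proxy n theta vs res (gam i0)
   + 3 * ((L + 2 * eta + Z w / eta) / n%:R)
   + 4 * (Xerr w * G / n%:R)
   + rho * ((vs + Xerr w) * sqnorm n (gam i0) / n%:R))))).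
- by move=> w; rewrite /loss addr_ge0// sumr_ge0// => j _; exact: sqr_ge0.
- apply: (@measurable_select _ _ _ _ _ ghat gam (fun g w => loss n theta (xi ^~ w) res g)) => // i.
  apply: measurable_funD => //; apply: measurable_sum => j.
  apply: measurable_funX; apply: measurable_funB => //.
  apply: measurable_funM => //; apply: measurable_funD => //.
  by apply: measurable_funM.
- apply: filterS ghat_min => w hw.
  rewrite -ler_pdivrMl ?invr_gt0 ?subr_gt0// invrK.
  have [i ei] := ghat_range w.
  have sh0 : 0 <= shat w by apply: sumr_ge0 => j _; exact: sqr_ge0.
  have dh : `|var_defect n v vs (high R n)| <= L.
    by apply: defect_le => j; rewrite /high; case: ltnP; rewrite ?normr1 ?normr0.
  have shX := variance_estimator_error theta (xi ^~ w) n0 (ltW vs0) dh.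
  apply: le_trans (oracle_pathwise n0 eta0 res0 kappa0 vs_gt u1 rho0 sh0 shX (Z := Z w) (G := G) _ hw) _; last first.
    by rewrite -/Theta -/(Xerr w).
  suff H i' : [/\ `|var_defect n v vs (wsq (gam i'))| <= L,
     `|var_defect n v vs (wcost (gam i'))| <= L,
     noise_sq n theta (xi ^~ w) v (gam i') <= Z w & 0 <= mass n (gam i') <= G].
    by move=> h [->|->]; rewrite ?ei; exact: H.
  split.
  + apply: defect_le => j; have /andP[g0 g1] := gam01 i' j.
    by rewrite /wsq ger0_norm ?sqr_ge0// exprn_ile1.
  + apply: defect_le => j; have /andP[g0 g1] := gam01 i' j.
    by rewrite /wcost ler_norml; apply/andP; split; nra.
  + rewrite /Z (bigD1 i')//= lerDl sumr_ge0// => i'' _.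
    by have [_ + _] := noise_sq_mean (gam01 i''); exact.
  + rewrite gamG andbT; apply: sumr_ge0 => j _; by have /andP[] := gam01 i' j.
- have u10 : 0 <= 1 + u by rewrite addr_ge0// ltW.
  apply: mean_leZ; first by rewrite invr_ge0 subr_ge0 ltW.
  apply: mean_leZ => //.
  apply: mean_leD; first (apply: mean_leD; first apply: mean_leD).
  + apply: mean_le_cst; rewrite mulr_ge0// addr_ge0//; first by rewrite addr_ge0 ?bias2_ge0.
    by rewrite divr_ge0// ?mulr_ge0// ltW.
  + apply: mean_leZ => //; apply: mean_le_div => //; apply: mean_leD.
      by apply: mean_le_cst; rewrite addr_ge0// mulr_ge0// ltW.
    exact: mean_le_div.
  + apply: mean_leZ => //; apply: mean_le_div => //.
    rewrite (_ : (fun _ => _) = fun w => G * Xerr w); last by apply/funext => w; rewrite mulrC.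
    by rewrite [_ * G]mulrC; exact: mean_leZ.
  + apply: mean_leZ => //; apply: mean_le_div => //.
    rewrite (_ : (fun _ => _) = fun w => sqnorm n (gam i0) * (vs + Xerr w)); last first.
      by apply/funext => w; rewrite mulrC.
    rewrite [_ * sqnorm n _]mulrC; apply: mean_leZ => //; apply: mean_leD => //.
    by apply: mean_le_cst; exact: ltW.
Qed.

End oracle.


(** * The noise coefficients of the model *)

Section link.
Context (R : realType).
Local Notation mu := (@lebesgue_measure R).

Lemma sum_ge1E (u : nat -> R) n : (forall j, (n < j)%N -> u j = 0) ->
  sum_ge1 u = \sum_(1 <= j < n.+1) u j.
Proof.
move=> u0; rewrite /sum_ge1; apply: cvg_lim => //.
apply: cvg_near_cst; near=> N.
have nN : (n < N)%N by near: N; exact: nbhs_infty_gt.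
rewrite (@big_cat_nat _ _ _ n.+1)//= [X in _ + X]big_nat_cond.
rewrite [X in _ + X]big1 ?addr0// => j /andP[/andP[nj _] _].
exact: u0.
Unshelve. all: by end_near. Qed.

(** Indices start at 1, so the support is a subset of the image of [`I_n] under the
    successor. *)
Lemma card_supp_leP n (x : nat -> R) : (forall j, (n < j)%N -> x j = 0) ->
  card_supp_le n x.
Proof.
move=> x0; apply: card_le_trans (card_image_le succn `I_n).
apply: subset_card_le => j /= [j1 xj]; exists j.-1; last exact: prednK.
rewrite /= prednK// leqNgt; apply/negP => nj.
by move: xj; rewrite x0// normr0 ltxx.
Qed.

Lemma L2_continuous (T : R) f : continuous f -> L2 T f.
Proof.
move=> cf; split.
  by apply: measurable_funTS; exact: continuous_measurable_fun.
have /integrableP[mf2] := @integrable_continuous R 0 T (fun t => f t ^+ 2) (continuousX_fun cf).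
apply: le_lt_trans; apply: ge0_le_integral => //.
- by move=> x _; rewrite lee_fin sqr_ge0.
- exact: measurableT_comp.
- by move=> x _; exact: lee_abs.
Qed.

Lemma integral_Rintegral (a b : R) f : continuous f ->
  (\int[mu]_(t in `[a, b]) (f t)%:E = (\int[mu]_(t in `[a, b]) f t)%:E)%E.
Proof.
move=> cf; rewrite /Rintegral fineK//.
by apply: integrable_fin_num => //; exact: integrable_continuous.
Qed.

Context (n : nat) (Q : probability (DT (n%:R : R)) R).
Context (I : (R -> R) -> DT (n%:R : R) -> R) (s vs l : R).
Hypothesis n0 : (0 < n)%N.
Hypothesis SI : stochastic_integral Q s I.
Hypothesis s0 : 0 <= s.
Hypothesis Lle : (L1n Q I vs + L2n Q I <= l%:E)%E.

Local Notation xi := (xi_coef I).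
Local Notation phi := (@phi R).
Definition xi_var j := fine 'E_Q[(fun w => xi j w ^+ 2)%R]%E.

Lemma xi_measurable j : measurable_fun setT (xi j).
Proof.
have [mI _ _ _ _] := SI.
apply: measurable_funM => //; apply: mI.
exact/L2_continuous/phi_continuous.
Qed.

Lemma stochastic_integral_sum (N : nat) (a : nat -> R) :
  {ae Q, forall w, I (fun t => \sum_(1 <= j < N) a j * phi j t) w =
    \sum_(1 <= j < N) a j * I (phi j) w}.
Proof.
have [mI linI _ _ _] := SI.
have c0 : continuous (fun _ : R => 0 : R) by exact: cst_continuous.
(* Linearity at [1 * 0 + 0] gives [I 0 = 2 * I 0]. *)
have I0 : {ae Q, forall w, I (fun=> 0) w = 0}.
  have := linI 1 _ _ (L2_continuous _ c0) (L2_continuous _ c0); apply: filterS => w /=.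
  have -> : (fun _ : R => 1 * 0 + 0 : R) = fun=> 0.
    by apply/funext => t; rewrite mulr0 addr0.
  by move=> h; move: (I _ w) h => z h; lra.
have base M : (M <= 1)%N -> (fun t => \sum_(1 <= j < M) a j * phi j t) = fun=> 0.
  by move=> M1; apply/funext => t; rewrite big_geq.
elim: N => [|N IH]; first by apply: filterS I0 => w Iw; rewrite base// big_geq.
have [N1|N1] := posnP N.
  by apply: filterS I0 => w Iw; rewrite N1 base// big_geq.
have cS : continuous (fun t => \sum_(1 <= j < N) a j * phi j t).
  by apply: continuous_sum => j; apply: continuousZ_fun; exact: phi_continuous.
have := linI (a N) _ _ (L2_continuous _ (@phi_continuous R N)) (L2_continuous _ cS).
apply: filterS2 IH => w IH linw.
rewrite big_nat_recr//= -IH addrC -linw; congr I.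
by apply/funext => t; rewrite big_nat_recr//= addrC.
Qed.

(** By linearity a combination of noise coefficients is the stochastic integral of
    one trigonometric polynomial, and orthonormality computes the norm of the
    latter. *)
Lemma lin_noise_mean a :
  mean_le Q (fun w => lin_noise n (xi ^~ w) a ^+ 2) (s * sqnorm n a).
Proof.
have [mI linI _ _ secI] := SI.
have nR0 : 0 < n%:R :> R by rewrite ltr0n.
have mlin : measurable_fun setT (fun w => lin_noise n (xi ^~ w) a ^+ 2).
  apply: measurable_funX; apply: measurable_sum => j.
  by apply: measurable_funM => //; exact: xi_measurable.
split => //; first by move=> w; exact: sqr_ge0.
pose f t := \sum_(1 <= j < n.+1) a j * phi j t.
have cf : continuous f.
  by apply: continuous_sum => j; apply: continuousZ_fun; exact: phi_continuous.
apply: (@mean_le_ae _ _ _ _ _ (fun w => n%:R^-1 * I f w ^+ 2)) => //.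
- by move=> w; exact: sqr_ge0.
- apply: filterS (stochastic_integral_sum n.+1 a) => w Iw.
  rewrite /f Iw /lin_noise.
  rewrite (eq_bigr (fun j => (Num.sqrt n%:R)^-1 * (a j * I (phi j) w))); last first.
    by move=> j _; rewrite /xi_coef mulrCA.
  by rewrite -mulr_sumr exprMn exprVn sqr_sqrtr ?ler0n.
- rewrite (_ : s * sqnorm n a = n%:R^-1 * (s * (n%:R * sqnorm n a))); last first.
    by field; rewrite gt_eqF.
  apply: mean_leZ; first by rewrite invr_ge0 ltW.
  split.
  + by apply: measurable_funX; apply: mI; exact: L2_continuous.
  + by move=> w; exact: sqr_ge0.
  + have := secI _ (L2_continuous _ cf).
    rewrite unlock integral_Rintegral; last exact: continuousX_fun.
    rewrite int_periodic; last 2 first.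
    * exact: continuousX_fun.
    * by move=> x; rewrite /f; under eq_bigr do rewrite phi_periodic.
    by rewrite int01_trig_sqr EFinM.
Qed.

Definition trunc_seq (x : nat -> R) j : R := if (j <= n)%N then x j else 0.

Lemma trunc_seq_out x j : (n < j)%N -> trunc_seq x j = 0.
Proof. by rewrite /trunc_seq ltnNge; case: leqP. Qed.

Lemma sum_trunc x (F : nat -> R -> R) : (forall j, F j 0 = 0) ->
  sum_ge1 (fun j => F j (trunc_seq x j)) = \sum_(1 <= j < n.+1) F j (x j).
Proof.
move=> F0; rewrite (@sum_ge1E _ n); last by move=> j nj; rewrite trunc_seq_out.
by apply: eq_big_nat => j /andP[_ jn]; rewrite /trunc_seq -ltnS jn.
Qed.

Lemma L1n_ge x : (forall j, `|x j| <= 1) ->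
  (`|var_defect n xi_var vs x|%:E <= L1n Q I vs)%E.
Proof.
move=> x1; apply: ereal_sup_ubound; exists (trunc_seq x).
  split; last by apply: card_supp_leP => j; exact: trunc_seq_out.
  move=> j; rewrite /trunc_seq -ler_norml; case: ifP => // _.
  by rewrite normr0.
by rewrite (@sum_trunc x (fun j y => y * (xi_var j - vs)))// => j; rewrite mul0r.
Qed.

Lemma L2n_ge x : sqnorm n x <= 1 ->
  (\int[Q]_w (quad_noise n (xi ^~ w) xi_var x ^+ 2)%:E <= L2n Q I)%E.
Proof.
move=> x1; apply: ereal_sup_ubound; exists (trunc_seq x).
  split; first by apply: card_supp_leP => j; exact: trunc_seq_out.
  by rewrite (@sum_trunc x (fun j y => y ^+ 2))// => j; rewrite expr0n.
rewrite [LHS](_ : _ = \int[Q]_w ((sum_ge1 (fun j => trunc_seq x j *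
  (xi j w ^+ 2 - xi_var j))) ^+ 2)%:E)%E; last by rewrite /xi_var unlock.
apply: eq_integral => w _; congr ((_ ^+ 2)%:E).
by rewrite (@sum_trunc x (fun j y => y * (xi j w ^+ 2 - xi_var j)))// => j; rewrite mul0r.
Qed.

Lemma L1n_ge0 : (0 <= L1n Q I vs)%E.
Proof.
apply: le_trans (@L1n_ge (fun=> 0) _); first by rewrite lee_fin.
by move=> j; rewrite normr0.
Qed.

Lemma L2n_ge0 : (0 <= L2n Q I)%E.
Proof.
apply: le_trans (@L2n_ge (fun=> 0) _).
  by apply: integral_ge0 => w _; rewrite lee_fin sqr_ge0.
by rewrite /sqnorm big1// => j _; rewrite expr0n.
Qed.

Lemma var_defect_le x : (forall j, `|x j| <= 1) -> `|var_defect n xi_var vs x| <= l.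
Proof.
move=> x1; rewrite -lee_fin; apply: le_trans (L1n_ge x1) (le_trans _ Lle).
by rewrite leeDl// L2n_ge0.
Qed.

(** [L2n] is a supremum over the unit ball; homogeneity gives the other
    coefficients. *)
Lemma quad_noise_mean x :
  mean_le Q (fun w => quad_noise n (xi ^~ w) xi_var x ^+ 2) (l * sqnorm n x).
Proof.
have [q0|q0] := eqVneq (sqnorm n x) 0.
  have x0 j : (1 <= j < n.+1)%N -> x j = 0.
    move=> jn; apply/eqP; rewrite -sqrf_eq0; move: q0 => /eqP.
    rewrite /sqnorm big_nat psumr_eq0; last by move=> ? _; exact: sqr_ge0.
    move=> /allP/(_ j); rewrite mem_index_iota jn => /(_ isT).
    by [].
  rewrite q0 mulr0 (_ : (fun _ => _) = fun=> 0); first exact: mean_le_cst.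
  apply/funext => w; rewrite /quad_noise big_nat big1 ?expr0n// => j jn.
  by rewrite x0// mul0r.
have qp : 0 < sqnorm n x by rewrite lt_neqAle eq_sym q0 sqnorm_ge0.
pose y j := x j / Num.sqrt (sqnorm n x).
have y1 : sqnorm n y <= 1.
  rewrite /sqnorm; under eq_bigr do rewrite /y expr_div_n sqr_sqrtr ?sqnorm_ge0//.
  by rewrite -mulr_suml divff.
have qE w : quad_noise n (xi ^~ w) xi_var x ^+ 2 =
    sqnorm n x * quad_noise n (xi ^~ w) xi_var y ^+ 2.
  rewrite /quad_noise -[in RHS](sqr_sqrtr (sqnorm_ge0 n x)) -exprMn mulr_sumr.
  congr (_ ^+ 2); apply: eq_bigr => j _; rewrite /y.
  by field; rewrite gt_eqF// sqrtr_gt0.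
rewrite (_ : (fun _ => _) = fun w => sqnorm n x * quad_noise n (xi ^~ w) xi_var y ^+ 2); last first.
  by apply/funext => w; exact: qE.
rewrite mulrC; apply: mean_leZ; first exact: sqnorm_ge0.
split.
- apply: measurable_funX; apply: measurable_sum => j.
  apply: measurable_funM => //; apply: measurable_funB => //.
  by apply: measurable_funX; exact: xi_measurable.
- by move=> w; exact: sqr_ge0.
- apply: le_trans (L2n_ge y1) (le_trans _ Lle).
  by rewrite leeDr// L1n_ge0.
Qed.

End link.


(** * The weights *)

Section weights.
Context (R : realType).

Lemma sum_leq_indicator n m : \sum_(1 <= j < n.+1) (j <= m)%N%:R <= m%:R :> R.
Proof.
suff -> : \sum_(1 <= j < n.+1) (j <= m)%N%:R = (minn n m)%:R :> R.
  by rewrite ler_nat geq_minr.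
elim: n => [|n IH]; first by rewrite big_geq// min0n.
rewrite big_nat_recr//= IH -natrD; congr (_%:R).
by case: leqP => ?; lia.
Qed.

Lemma tau_w_gt0 b : (1 <= b)%N -> 0 < tau_w R b.
Proof.
move=> b1; rewrite /tau_w divr_gt0// ?mulr_gt0 ?exprn_gt0 ?pi_gt0 ?ltr0n//.
Qed.

Lemma tau_w_le6 b : (1 <= b)%N -> tau_w R b <= 6.
Proof.
move=> b1; rewrite /tau_w.
have p0 : 0 < pi ^+ (2 * b) * b%:R :> R by rewrite mulr_gt0 ?exprn_gt0 ?pi_gt0 ?ltr0n.
rewrite ler_pdivrMr//.
apply: (@le_trans _ _ (6 * ((2 ^ (2 * b))%:R * b%:R))).
  rewrite -!natrM ler_nat.
  have h : (b < 2 ^ (2 * b))%N.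
    by apply: leq_trans (ltn_expl b (isT : (1 < 2)%N)) _; rewrite leq_pexp2l//; lia.
  by nia.
by rewrite ler_pM2l// ler_wpM2r// natrX lerXn2r ?nnegrE ?pi_ge0// pi_ge2.
Qed.

Context (n b : nat) (t : R).
Hypothesis b1 : (1 <= b)%N.
Hypothesis t0 : 0 < t.
Hypothesis ln1 : 1 <= ln n%:R :> R.
Local Notation om := (omega_w n b t).
Local Notation j0 := (Num.truncn (om / ln n%:R)).

Let n0 : (0 < n)%N.
Proof. by rewrite lt0n; apply/eqP => n0; move: ln1; rewrite n0 ln0// ler10. Qed.

Lemma omega_w_gt0 : 0 < om.
Proof.
apply: powR_gt0; apply: mulr_gt0; last by rewrite ltr0n.
by apply: mulr_gt0 => //; exact: tau_w_gt0.
Qed.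
Let om0 := omega_w_gt0.

(** A bound of the support that is uniform over the grid: the exponent is largest
    at [b = 1]. *)
Lemma omega_w_le (e : R) : 0 < e -> t <= e^-1 -> e <= 1 ->
  om <= (6 * n%:R / e) `^ (3^-1).
Proof.
move=> e0 te e1; have x1 : 1 <= 6 * n%:R / e.
  rewrite ler_pdivlMr// mul1r (le_trans e1)//.
  have : (1 : R) <= n%:R by rewrite ler1n.
  by lra.
apply: (@le_trans _ _ ((6 * n%:R / e) `^ ((2 * b + 1)%:R^-1))).
  apply: ge0_ler_powR; rewrite ?nnegrE ?invr_ge0//.
  - by apply: mulr_ge0 => //; apply: mulr_ge0; [exact/ltW/tau_w_gt0|exact: ltW].
  - by rewrite (le_trans _ x1).
  - rewrite [leRHS]mulrAC ler_wpM2r// ler_pM// ?(ltW (tau_w_gt0 b1)) ?(ltW t0)//.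
    exact: tau_w_le6.
apply: ler_powR => //; rewrite lef_pV2 ?posrE ?ltr0n ?addn1// ler_nat; lia.
Qed.

Lemma j0_le : j0%:R <= om / ln n%:R.
Proof. by rewrite truncn_le divr_ge0 ?(ltW om0) ?(le_trans _ ln1). Qed.

Lemma j0_le_omega : j0%:R <= om.
Proof.
apply: le_trans j0_le _; rewrite ler_pdivrMr ?(lt_le_trans _ ln1)//.
by rewrite ler_peMr// ltW.
Qed.

Lemma gamma_w01 j : 0 <= gamma_w n b t j <= 1.
Proof.
rewrite /gamma_w; case: ifP => _; first by rewrite ler01 lexx.
case: ifP => [/andP[_ jom]|_]; last by rewrite lexx ler01.
have h : j%:R / om <= 1 by rewrite ler_pdivrMr// mul1r.
have h0 : 0 <= j%:R / om by rewrite divr_ge0// ltW.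
by rewrite subr_ge0 exprn_ile1//= lerBlDr lerDl exprn_ge0.
Qed.

Lemma gamma_w_out j : om < j%:R -> gamma_w n b t j = 0.
Proof.
move=> omj; rewrite /gamma_w.
have jj0 : (j0 < j)%N by rewrite -(ltr_nat R) (le_lt_trans j0_le_omega).
by rewrite [(j <= j0)%N]leqNgt jj0 andbF/= leNgt omj.
Qed.

Lemma gamma_w_mass : mass n (gamma_w n b t) <= om.
Proof.
apply: (@le_trans _ _ (Num.truncn om)%:R); last by rewrite truncn_le ltW.
apply: le_trans (sum_leq_indicator n _); apply: ler_sum => j _.
have [jm|mj] := leqP j (Num.truncn om); first by have /andP[] := gamma_w01 j.
rewrite gamma_w_out//; apply: lt_le_trans (truncnS_gt _) _.
by rewrite ler_nat.
Qed.

Local Notation c := (2 * b%:R ^+ 2 / (b.+1%:R * (2 * b + 1)%:R) : R).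

(** A primitive of [(1 - x ^+ b) ^+ 2]. *)
Let prim (x : R) := x - 2 / b.+1%:R * x ^+ b.+1 + (2 * b).+1%:R^-1 * x ^+ (2 * b).+1.

Lemma prim_derive x : is_derive x (1 : R) prim ((1 - x ^+ b) ^+ 2).
Proof.
have dX p : is_derive x (1 : R) (fun y => y ^+ p.+1) (p.+1%:R * x ^+ p).
  have := @is_deriveX R R id p.+1 x 1 1 _.
  by rewrite /GRing.scale/= mulr1 exprfctE; apply; exact: is_derive_id.
have dZ a p : is_derive x (1 : R) (fun y => a * y ^+ p.+1) (a * (p.+1%:R * x ^+ p)).
  by have := @is_deriveZ _ _ _ _ a _ _ _ (dX p).
have d1 := dZ (2 / b.+1%:R) b; have d2 := dZ (2 * b).+1%:R^-1 (2 * b)%N.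
rewrite /prim; apply: is_derive_eq.
rewrite mulrA divfK ?pnatr_eq0// mulrA mulVf ?pnatr_eq0// mul1r mulnC exprM.
by ring.
Qed.

(** The integrand decreases on [0, 1], so on each step the Riemann sum taken at the
    right end point is below the integral. *)
Lemma prim_step x y : 0 <= y -> y < x -> x <= 1 ->
  (1 - x ^+ b) ^+ 2 * (x - y) <= prim x - prim y.
Proof.
move=> y0 yx x1.
have cp : continuous prim.
  by move=> z; apply/differentiable_continuous/derivable1_diffP; have [] := prim_derive z.
have [z] := @MVT R prim _ y x yx (fun z _ => prim_derive z) (continuous_subspaceT cp).
rewrite in_itv/= => /andP[yz zx] ->.
rewrite ler_pM2r ?subr_gt0// lerXn2r ?nnegrE ?subr_ge0 ?exprn_ile1//.
- exact: le_trans (ltW yx).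
- exact: le_trans (ltW yz).
- exact: le_trans (ltW zx) x1.
- by rewrite lerD2l lerN2 lerXn2r ?nnegrE ?(ltW zx)// ?(le_trans y0 (ltW _))// (le_trans y0)// ltW.
Qed.

(** The weights equal to 1 contribute [om / ln n]; the others form a Riemann sum of
    [(1 - x ^ b) ^ 2] with step [1 / om], and [c] is the integral of this function
    over [0, 1]. *)
Lemma gamma_w_sqnorm : sqnorm n (gamma_w n b t) <= om / ln n%:R + c * om.
Proof.
pose F j := (1 - (j%:R / om) ^+ b) ^+ 2.
apply: (@le_trans _ _ (\sum_(1 <= j < n.+1) ((j <= j0)%N%:R + (j <= Num.truncn om)%N%:R * F j))).
  apply: ler_sum => j _; rewrite /gamma_w /F.
  case: ifP => [/andP[_ jj0]|_].
    by rewrite jj0 expr1n lerDl mulr_ge0// sqr_ge0.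
  case: ifP => [/andP[_ jom]|_].
    have -> : (j <= Num.truncn om)%N by rewrite truncn_ge_nat// ltW.
    by rewrite mul1r lerDr.
  by rewrite expr0n addr_ge0// mulr_ge0// sqr_ge0.
rewrite big_split/= lerD//; first exact: le_trans (sum_leq_indicator n _) j0_le.
set m := Num.truncn om.
have mom : m%:R <= om by rewrite truncn_le ltW.
apply: (@le_trans _ _ (\sum_(1 <= j < m.+1) F j)).
  have [nm|mn] := leqP n m.
    rewrite [leRHS](@big_cat_nat _ _ _ n.+1)//= -[leLHS]addr0 lerD//.
      by apply: ler_sum => j _; rewrite ler_piMl ?sqr_ge0// lern1 leq_b1.
    by apply: sumr_ge0 => j _; exact: sqr_ge0.
  rewrite [leLHS](@big_cat_nat _ _ _ m.+1)//=; last by rewrite ltnS ltnW.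
  rewrite [X in _ + X]big_nat_cond [X in _ + X]big1 ?addr0.
    by apply: ler_sum => j _; rewrite ler_piMl ?sqr_ge0// lern1 leq_b1.
  by move=> j /andP[/andP[mj _] _]; rewrite leqNgt mj mul0r.
have H p : p%:R <= om -> \sum_(1 <= j < p.+1) F j <= om * prim (p%:R / om).
  elim: p => [|p IH] pom.
    by rewrite big_geq// mul0r /prim !expr0n/= !mulr0 subrr add0r mulr0.
  have pom' : p%:R <= om by apply: le_trans pom; rewrite ler_nat.
  rewrite big_nat_recr//=; apply: le_trans (lerD (IH pom') (lexx _)) _.
  rewrite -lerBrDl -mulrBr.
  have := @prim_step (p.+1%:R / om) (p%:R / om) _ _ _.
  rewrite -mulrBl -natrB// subSnn mul1r => h.
  rewrite mulrC -ler_pdivrMr//; apply: h.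
  - by rewrite divr_ge0// ltW.
  - by rewrite ltr_pM2r ?invr_gt0// ltr_nat.
  - by rewrite ler_pdivrMr// mul1r.
apply: le_trans (H m mom) _.
rewrite mulrC ler_pM2r//.
apply: (@le_trans _ _ (prim 1)).
  have : m%:R / om <= 1 by rewrite ler_pdivrMr// mul1r.
  rewrite le_eqVlt => /predU1P[->//|mlt].
  have := @prim_step 1 (m%:R / om) _ mlt (lexx _).
  rewrite expr1n subrr expr0n mul0r subr_ge0; apply.
  by rewrite divr_ge0// ltW.
rewrite /prim !expr1n !mulr1 le_eqVlt; apply/orP; left; apply/eqP.
rewrite -!natr1 natrD !natrM; field.
by rewrite -natrM !natr1 !pnatr_eq0.
Qed.

(** On the ellipsoid the bias is at most the largest ratio of [(1 - g j) ^ 2] to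
    [freq j ^ (2 k)]. The weight 1 on the first frequencies removes those for which
    [freq j] is far below [pi j]; beyond [j0] the ratio of [pi j] to [freq j] is at most
    [1 + 1 / j0]. *)
Lemma gamma_w_bias k r S : b = k -> (1 <= j0)%N -> sobolev_ball k r S ->
  bias2 n (fcoef S) (gamma_w n b t) <=
  ((1 + j0%:R^-1) / (pi * om)) ^+ (2 * k) * r.
Proof.
move=> bk j01 SB.
have pom : 0 < pi * om by rewrite mulr_gt0// pi_gt0.
have j0R : 0 < j0%:R :> R by rewrite ltr0n.
have a0 : 0 <= (1 + j0%:R^-1) / (pi * om).
  by rewrite divr_ge0 ?(ltW pom)// addr_ge0// invr_ge0 ltW.
have k1 : (1 <= k)%N by rewrite -bk.
apply: (@le_trans _ _ (((1 + j0%:R^-1) / (pi * om)) ^+ (2 * k) *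
    \sum_(1 <= j < n.+1) freq R j ^+ (2 * k) * fcoef S j ^+ 2)); last first.
  by rewrite ler_wpM2l ?exprn_ge0//; exact: sobolev_bound.
rewrite mulr_sumr; apply: ler_sum_nat => j /andP[j1 _].
rewrite [leRHS]mulrA ler_wpM2r ?sqr_ge0// -exprMn [(2 * k)%N]mulnC exprM.
have fr0 : 0 <= freq R j by rewrite !mulr_ge0// pi_ge0.
have af0 : 0 <= (1 + j0%:R^-1) / (pi * om) * freq R j by rewrite mulr_ge0.
suff h : 1 - gamma_w n b t j <= ((1 + j0%:R^-1) / (pi * om) * freq R j) ^+ k.
  rewrite lerXn2r ?nnegrE ?exprn_ge0//.
  by have /andP[_] := gamma_w01 j; rewrite subr_ge0.
have main : (j0 < j)%N -> j%:R / om <= (1 + j0%:R^-1) / (pi * om) * freq R j.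
  move=> jj0.
  have f1 : pi * (j%:R - 1) <= freq R j.
    rewrite /freq [2 * pi]mulrC -mulrA ler_pM2l ?pi_gt0// lerBlDr -natrM natr1 ler_nat; lia.
  apply: (@le_trans _ _ ((1 + j0%:R^-1) / (pi * om) * (pi * (j%:R - 1)))).
    rewrite invfM -!mulrA [pi^-1 * _]mulrCA !mulrA mulrVK ?unitfE ?gt_eqF ?pi_gt0//.
    rewrite [leRHS]mulrAC ler_pM2r ?invr_gt0// mulrDl mul1r.
    have : 1 <= j0%:R^-1 * (j%:R - 1) :> R.
      rewrite mulrC ler_pdivlMr// mul1r lerBrDr natr1 ler_nat//.
    by lra.
  by rewrite ler_wpM2l.
rewrite /gamma_w; case: ifP => [_|jj0].
  by rewrite subrr exprn_ge0.
have {}jj0 : (j0 < j)%N by rewrite ltnNge; move: jj0; rewrite j1/= => ->.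
have jom0 : 0 <= j%:R / om by rewrite divr_ge0// ltW.
case: ifP => [_|].
  rewrite opprB addrCA subrr addr0 -bk lerXn2r ?nnegrE//.
  exact: main.
rewrite jj0/= => /negbT; rewrite -ltNge => omj.
rewrite subr0 exprn_ege1// (le_trans _ (main jj0))// ler_pdivlMr// mul1r.
exact: ltW.
Qed.

End weights.


(** * The risk at a fixed sample size *)

Section identities.
Context (R : realType) (n : nat).
Local Notation mu := (@lebesgue_measure R).
Local Notation D := (DT (n%:R : R)).
Hypothesis n0 : (0 < n)%N.
Context (I : (R -> R) -> D -> R) (S : R -> R).
Hypothesis cS : continuous S.
Hypothesis pS : forall x, S (x + 1) = S x.

Let nR0 : 0 < n%:R :> R. Proof. by rewrite ltr0n. Qed.

Lemma theta_hatE w : theta_hat I S w = observed n (fcoef S) ((xi_coef I) ^~ w).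
Proof.
apply/funext => j; rewrite /theta_hat /observed /xi_coef int_periodic; last 2 first.
- by apply: continuousM_fun => //; exact: phi_continuous.
- by move=> x; rewrite phi_periodic pS.
have sn2 : Num.sqrt n%:R * Num.sqrt n%:R = n%:R :> R by rewrite -expr2 sqr_sqrtr ?ler0n.
rewrite mulrDr mulKf ?gt_eqF//; congr (_ + _).
by rewrite mulrAC -invfM sn2.
Qed.

Lemma J_costE (rho : R) (theta xi g : nat -> R) : (forall j, (n < j)%N -> g j = 0) ->
  J_cost n rho (observed n theta xi) g =
  cost n theta xi rho (\sum_((Num.truncn (Num.sqrt (n%:R : R))).+1 <= j < n.+1)
    observed n theta xi j ^+ 2) g.
Proof.
move=> g0; rewrite /J_cost /cost /P_hat /theta_tilde /sigma_hat /sqnorm.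
rewrite !(@sum_ge1E _ _ n); first by [].
- by move=> j nj; rewrite g0// expr0n.
- by move=> j nj; rewrite g0// mul0r.
- by move=> j nj; rewrite g0// expr0n mul0r.
Qed.

Lemma integral_loss (theta xi g : nat -> R) : (forall j, (n < j)%N -> g j = 0) ->
  theta = fcoef S ->
  (\int[mu]_(x in `[0%R, 1%R])
     ((S_hat g (observed n theta xi) x - S x) ^+ 2)%:E)%E =
  (loss n theta xi (residual S n) g)%:E.
Proof.
move=> g0 ->; set th := observed _ _ _.
have SE x : S_hat g th x = \sum_(1 <= j < n.+1) g j * th j * phi j x.
  by rewrite /S_hat (@sum_ge1E _ _ n)// => j nj; rewrite g0// !mul0r.
under eq_integral do rewrite SE.
have cT : continuous (fun x => \sum_(1 <= j < n.+1) g j * th j * phi j x).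
  by apply: continuous_sum => j; apply: continuousZ_fun; exact: phi_continuous.
rewrite (integral_Rintegral 0 1 (f := fun x => (\sum_(1 <= j < n.+1) g j * th j * phi j x - S x) ^+ 2)); last first.
  by apply: continuousX_fun; exact: continuousB_fun.
by rewrite -/(int01 _) (@int01_trig_error _ n.+1 (fun j => g j * th j)).
Qed.

End identities.

Section risk_bound.
Context (R : realType) (n k K : nat) (r e rho eta vs_lo vs_up s_up l : R) (i0 : nat).
Local Notation D := (DT (n%:R : R)).
Local Notation om := (omega_w n k (i0.+1%:R * e)).
Local Notation j0 := (Num.truncn (om / ln n%:R)).
Local Notation u := (eta * (1 + vs_lo^-1)).

(** The quantities of the oracle inequality, bounded uniformly over the noise
    distributions and over the Sobolev ball. *)
Definition omega_bound : R := (6 * n%:R / e) `^ (3^-1).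
Definition bias_bound : R := ((1 + j0%:R^-1) / (pi * om)) ^+ (2 * k) * r.
Definition sqnorm_bound : R :=
  om / ln n%:R + 2 * k%:R ^+ 2 / (k.+1%:R * (2 * k + 1)%:R) * om.
Definition noise_level : R := l + 2 * eta
  + (2 * s_up + 5 * l) *+ (K * Num.truncn (e ^- 2)) / eta.
Definition variance_bound : R := (2 + r + s_up * r + 2 * l + vs_up) / Num.sqrt n%:R.

Definition risk_bound : R := (1 - u)^-1 * ((1 + u) *
  ((1 + u) * (bias_bound + r / n%:R + vs_up * sqnorm_bound / n%:R)
   + 3 * (noise_level / n%:R)
   + 4 * (variance_bound * omega_bound / n%:R)
   + rho * ((vs_up + variance_bound) * sqnorm_bound / n%:R))).

Hypothesis n0 : (0 < n)%N.
Hypothesis k1 : (1 <= k)%N.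
Hypothesis r0 : 0 < r.
Hypothesis e0 : 0 < e.
Hypothesis e1 : e <= 1.
Hypothesis rho0 : 0 <= rho.
Hypothesis eta0 : 0 < eta.
Hypothesis vs_lo0 : 0 < vs_lo.
Hypothesis u1 : u < 1.
Hypothesis ln1 : 1 <= ln n%:R :> R.
Hypothesis omn : omega_bound <= n%:R.
Hypothesis kK : (k <= K)%N.
Hypothesis i0M : (i0 < Num.truncn (e ^- 2))%N.
Hypothesis j01 : (1 <= j0)%N.

Local Notation grid := ('I_K * 'I_(Num.truncn (e ^- 2)))%type.
Let gam (a : grid) : nat -> R := gamma_w n a.1.+1 (a.2.+1%:R * e).

Lemma Gamma_setP g : Gamma_set n K e g <-> exists a, g = gam a.
Proof.
split.
- move=> [[b t] [/= /andP[b1 bK] [i [/andP[i1 iM] ->]]] <-].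
  have bK' : (b.-1 < K)%N by rewrite prednK.
  have iM' : (i.-1 < Num.truncn (e ^- 2))%N by rewrite prednK.
  by exists (Ordinal bK', Ordinal iM'); rewrite /gam/= !prednK.
- move=> [[b i] ->]; exists (b.+1, i.+1%:R * e) => //; split => //=.
  by exists i.+1; split => //=.
Qed.

Let node_gt0 i : 0 < i.+1%:R * e. Proof. by rewrite mulr_gt0 ?ltr0n. Qed.

Lemma node_le (a : grid) : a.2.+1%:R * e <= e^-1.
Proof.
rewrite -ler_pdivlMr// -expr2 exprVn.
have : a.2.+1%:R <= (Num.truncn (e ^- 2))%:R :> R by rewrite ler_nat.
move=> h; apply: le_trans h _; rewrite truncn_le.
by rewrite invr_ge0 exprn_ge0// ltW.
Qed.

Lemma gam_mass a : mass n (gam a) <= omega_bound.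
Proof.
apply: le_trans (gamma_w_mass _ _ _) _ => //.
by apply: omega_w_le => //; exact: node_le.
Qed.

Lemma gam_out a j : (n < j)%N -> gam a j = 0.
Proof.
move=> nj; apply: gamma_w_out => //.
apply: (@le_lt_trans _ _ omega_bound); first by apply: omega_w_le => //; exact: node_le.
by rewrite (le_lt_trans omn)// ltr_nat.
Qed.

Context (Q : probability D R) (I : (R -> R) -> D -> R) (s vs : R).
Context (gamma_hat : (R -> R) -> nat -> R) (S : R -> R).
Hypothesis SI : stochastic_integral Q s I.
Hypothesis s0 : 0 <= s.
Hypothesis s_le : s <= s_up.
Hypothesis vs_ge : vs_lo <= vs.
Hypothesis vs_le : vs <= vs_up.
Hypothesis Lle : (L1n Q I vs + L2n Q I <= l%:E)%E.
Hypothesis SB : sobolev_ball k r S.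
Hypothesis range : forall y, Gamma_set n K e (gamma_hat y).
Hypothesis meas : forall g, Gamma_set n K e g ->
  measurable [set w : D | gamma_hat (observation S w) = g].
Hypothesis mini : {ae Q, forall w, is_minimizer n (Gamma_set n K e) rho
  (theta_hat I S w) (gamma_hat (observation S w))}.

(** The oracle inequality with the comparison weight at smoothness [k] and grid
    point [i0]. *)
Lemma risk_le_bound : (risk Q I gamma_hat S <= risk_bound%:E)%E.
Proof.
have CS := SB.1; have [pS _ _ _] := CS; have cS := Ck_per_continuous CS.
have nR0 : 0 < n%:R :> R by rewrite ltr0n.
have kK' : (k.-1 < K)%N by rewrite prednK.
pose a0 : grid := (Ordinal kK', Ordinal i0M).
have gam0 : gam a0 = gamma_w n k (i0.+1%:R * e) by rewrite /gam/= prednK.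
pose ghat (w : D) := gamma_hat (observation S w).
have ghat_range w : exists a, ghat w = gam a by apply/Gamma_setP; exact: range.
have ghat_out w j : (n < j)%N -> ghat w j = 0.
  by have [a ->] := ghat_range w; exact: gam_out.
have -> : risk Q I gamma_hat S =
    (\int[Q]_w (loss n (fcoef S) ((xi_coef I) ^~ w) (residual S n) (ghat w))%:E)%E.
  apply: eq_integral => w _; rewrite theta_hatE//.
  by apply: integral_loss => // j; exact: ghat_out.
have gam01 a j : 0 <= gam a j <= 1 by exact: gamma_w01.
have kap0 : 0 < vs_lo^-1 by rewrite invr_gt0.
have kvs : (vs_lo^-1)^-1 <= vs by rewrite invrK.
have gmeas a : measurable [set w | ghat w = gam a].
  by apply: meas; apply/Gamma_setP; exists a.
have gmin : {ae Q, forall w,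
  cost n (fcoef S) ((xi_coef I) ^~ w) rho (\sum_((Num.truncn (Num.sqrt (n%:R : R))).+1 <= j < n.+1)
    observed n (fcoef S) ((xi_coef I) ^~ w) j ^+ 2) (ghat w) <=
  cost n (fcoef S) ((xi_coef I) ^~ w) rho (\sum_((Num.truncn (Num.sqrt (n%:R : R))).+1 <= j < n.+1)
    observed n (fcoef S) ((xi_coef I) ^~ w) j ^+ 2) (gam a0)}.
  apply: filterS mini => w [_ /(_ (gam a0))].
  rewrite theta_hatE// !J_costE//; first by apply; apply/Gamma_setP; exists a0.
  - exact: gam_out.
  - exact: ghat_out.
have := oracle_mean n0 (xi_measurable SI) s0 (lin_noise_mean n0 SI)
  (var_defect_le Lle) (quad_noise_mean SI Lle) kvs kap0 eta0 rho0
  (residual_ge0 n cS) u1 gam01 gam_mass ghat_range gmeas gmin.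
move/le_trans; apply; rewrite lee_fin.
have u0 : 0 < u by rewrite mulr_gt0// addr_gt0.
have l0 : 0 <= l by exact: (defect_ge0 (var_defect_le Lle)).
have vs0 : 0 < vs by exact: lt_le_trans vs_ge.
have sn0 : 0 < Num.sqrt n%:R :> R by rewrite sqrtr_gt0.
have sn2 : Num.sqrt n%:R * Num.sqrt n%:R = n%:R :> R by rewrite -expr2 sqr_sqrtr ?ler0n.
have n1 : 1 <= n%:R :> R by rewrite ler1n.
have sn1 : 1 <= Num.sqrt n%:R :> R by rewrite -[X in X <= _]sqrtr1 ler_wsqrtr.
have resn : residual S n <= r / n%:R.
  apply: le_trans (sobolev_residual k1 n0 SB) _.
  have n1p : 0 < n.+1%:R :> R by rewrite ltr0n.
  have nn : n%:R <= n.+1%:R ^+ 2 :> R.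
    by rewrite expr2 -natr1; move: n1; move: n%:R => x x1; nra.
  by rewrite ler_pM2l// lef_pV2// posrE exprn_gt0.
pose m := Num.truncn (Num.sqrt (n%:R : R)).
have Theta_le : \sum_(m.+1 <= j < n.+1) fcoef S j ^+ 2 <= r / n%:R.
  have m1 : (1 <= m)%N by rewrite truncn_ge_nat// ltW.
  apply: le_trans (sobolev_sum_tail n.+1 k1 m1 SB) _.
  rewrite ler_pM2l// lef_pV2 ?posrE ?exprn_gt0 ?ltr0n// -sn2 -expr2.
  by rewrite lerXn2r ?nnegrE ?ltW// truncnS_gt.
have Theta0 : 0 <= \sum_(m.+1 <= j < n.+1) fcoef S j ^+ 2.
  by apply: sumr_ge0 => j _; exact: sqr_ge0.
have Ve : variance_error n (fcoef S) vs s l <= variance_bound.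
  rewrite /variance_error -/m; move: Theta_le Theta0; move: (\sum_(_ <= _ < _) _) => Th Th1 Th0.
  have rn : r / n%:R <= r / Num.sqrt n%:R.
    by rewrite ler_pM2l// lef_pV2 ?posrE// -[leRHS]sn2 ler_peMl// ltW.
  have rn1 : r / n%:R <= r by rewrite ler_pdivrMr// ler_peMr// ltW.
  rewrite /variance_bound.
  have h1 : s * Th <= s_up * r by apply: ler_pM => //; lra.
  have h2 : (2 + s * Th + l) / Num.sqrt n%:R <= (2 + s_up * r + l) / Num.sqrt n%:R.
    by rewrite ler_pM2r ?invr_gt0//; lra.
  have h3 : (l + vs * Num.sqrt n%:R) / n%:R <= (l + vs_up) / Num.sqrt n%:R.
    rewrite -{2}sn2 invfM mulrA ler_pM2r ?invr_gt0// ler_pdivrMr// mulrDl.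
    by apply: lerD; [rewrite ler_peMr|rewrite ler_pM2r].
  have -> : (2 + r + s_up * r + 2 * l + vs_up) / Num.sqrt n%:R =
    r / Num.sqrt n%:R + (2 + s_up * r + l) / Num.sqrt n%:R + (l + vs_up) / Num.sqrt n%:R.
    by rewrite -!mulrDl; congr (_ / _); ring.
  by lra.
have Ve0 : 0 <= variance_error n (fcoef S) vs s l.
  rewrite /variance_error -/m addr_ge0//; last first.
    by rewrite divr_ge0// ?addr_ge0// ?mulr_ge0// ltW.
  by rewrite addr_ge0// divr_ge0 ?(ltW sn0)// !addr_ge0// mulr_ge0.
have sq : sqnorm n (gam a0) <= sqnorm_bound by rewrite gam0; exact: gamma_w_sqnorm.
have sq0 := sqnorm_ge0 n (gam a0).
have bi : bias2 n (fcoef S) (gam a0) <= bias_bound by rewrite gam0; exact: gamma_w_bias.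
have G0 : 0 <= omega_bound by exact: powR_ge0.
rewrite /risk_bound ler_pM2l ?invr_gt0 ?subr_gt0// ler_pM2l ?addr_gt0//.
have nV : 0 < n%:R^-1 :> R by rewrite invr_gt0.
apply: lerD; first apply: lerD; first apply: lerD.
- rewrite ler_pM2l ?addr_gt0//; apply: lerD; first exact: lerD.
  by rewrite ler_pM2r//; apply: ler_pM => //; exact: ltW.
- rewrite ler_pM2l// ler_pM2r// /noise_level lerD2l ler_pM2r ?invr_gt0//.
  rewrite card_prod !card_ord ler_wMn2r// lerD2r ler_pM2l//.
- by rewrite ler_pM2l// ler_pM2r// ler_wpM2r.
- rewrite ler_wpM2l// ler_pM2r// ler_pM// ?lerD// addr_ge0//; exact: ltW.
Qed.

End risk_bound.


(** * Limits of sequences *)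

Section sequences.
Context (R : realType).
Implicit Types (u w : nat -> R) (a b d : R).

Lemma cvg_near_eq u w a : (\forall n \near \oo, u n = w n) ->
  w n @[n --> \oo] --> a -> u n @[n --> \oo] --> a.
Proof.
move=> uw wa; apply: cvg_trans wa; apply: near_eq_cvg.
by apply: filterS uw => n ->.
Qed.

Lemma cvg_squeeze0 u w : (\forall n \near \oo, 0 <= u n <= w n) ->
  w n @[n --> \oo] --> (0 : R) -> u n @[n --> \oo] --> (0 : R).
Proof.
move=> uw w0; apply: (@squeeze_cvgr _ _ _ _ (fun=> 0) w u uw 0 _ w0).
exact: cvg_cst.
Qed.

Lemma cvg_seqM u w a b : u n @[n --> \oo] --> a -> w n @[n --> \oo] --> b ->
  u n * w n @[n --> \oo] --> a * b.
Proof. exact: cvgM. Qed.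

Lemma cvg_seqD u w a b : u n @[n --> \oo] --> a -> w n @[n --> \oo] --> b ->
  u n + w n @[n --> \oo] --> a + b.
Proof. exact: cvgD. Qed.

Lemma cvg_seqZ c u a : u n @[n --> \oo] --> a -> c * u n @[n --> \oo] --> c * a.
Proof. exact: cvgMl_tmp. Qed.

Lemma cvg_seqV u a : a != 0 -> u n @[n --> \oo] --> a -> (u n)^-1 @[n --> \oo] --> a^-1.
Proof. exact: cvgV. Qed.

Lemma cvg_seqX u a m : u n @[n --> \oo] --> a -> u n ^+ m @[n --> \oo] --> a ^+ m.
Proof.
move=> ua; have h : (fun x : R => x ^+ m) @ a --> a ^+ m by exact: exprn_continuous.
exact: cvg_comp ua h.
Qed.

Lemma cvg_seq_cst a : (fun _ : nat => a) n @[n --> \oo] --> a.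
Proof. exact: cvg_cst. Qed.

Lemma cvg_seqV_infty u : u n @[n --> \oo] --> +oo -> (u n)^-1 @[n --> \oo] --> (0 : R).
Proof.
move=> uoo; apply/gtr0_cvgV0 => //.
by have := cvgry_gt uoo 0; apply.
Qed.

Lemma powR_nat_invV d : 0 < d -> (n%:R `^ d)^-1 @[n --> \oo] --> (0 : R).
Proof.
move=> d0; apply: cvg_seqV_infty; apply/cvgryPge => A; near=> n.
have [A0|A0] := leP A 0; first by apply: le_trans A0 _; exact: powR_ge0.
apply: (@le_trans _ _ ((A `^ d^-1) `^ d)).
  by rewrite -powRrM mulVf ?gt_eqF// powRr1// ltW.
apply: ge0_ler_powR; [exact: ltW|by rewrite nnegrE powR_ge0|by rewrite nnegrE ler0n|].
by near: n; exact: nbhs_infty_ger.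
Unshelve. all: by end_near. Qed.

Lemma ln_nat_near A : \forall n \near \oo, A <= ln (n%:R : R).
Proof.
near=> n; rewrite -[leLHS](@expRK R) ler_ln ?posrE ?expR_gt0//.
  by near: n; exact: nbhs_infty_ger.
by rewrite ltr0n; near: n; exact: nbhs_infty_gt.
Unshelve. all: by end_near. Qed.

Lemma ln_nat_invV : (ln n%:R)^-1 @[n --> \oo] --> (0 : R).
Proof. by apply: cvg_seqV_infty; apply/cvgryPge => A; exact: ln_nat_near. Qed.

(** Half of the power suffices to dominate the logarithm: [ln x < x] at
    [x = n ^ (d / 2)]. *)
Lemma ln_nat_powR d : 0 < d -> ln n%:R / n%:R `^ d @[n --> \oo] --> (0 : R).
Proof.
move=> d0; have d20 : 0 < d / 2 by rewrite divr_gt0.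
apply: (@cvg_squeeze0 _ (fun n => (d / 2)^-1 * (n%:R `^ (d / 2))^-1)); last first.
  by rewrite -[X in _ --> X](mulr0 (d / 2)^-1); apply: cvg_seqZ; exact: powR_nat_invV.
near=> n.
have n0 : 0 < n%:R :> R by rewrite ltr0n; near: n; exact: nbhs_infty_gt.
have ln0 : 0 <= ln (n%:R : R) by near: n; exact: ln_nat_near.
rewrite divr_ge0 ?powR_ge0//=.
have x0 : 0 < (n%:R : R) `^ (d / 2) by rewrite powR_gt0.
have -> : (n%:R : R) `^ d = n%:R `^ (d / 2) * n%:R `^ (d / 2).
  by rewrite -powRD ?gt_eqF ?implybT// -splitr.
rewrite invfM mulrA ler_pM2r ?invr_gt0// ler_pdivrMr// ler_pdivlMl//.
by rewrite -ln_powR ltW// ln_sublinear.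
Unshelve. all: by end_near. Qed.

Lemma cvg_seq_powR u a d : 0 < a -> u n @[n --> \oo] --> a ->
  u n `^ d @[n --> \oo] --> a `^ d.
Proof.
move=> a0 ua.
have /derivable1_diffP/differentiable_continuous h : derivable (@powR R ^~ d) a 1.
  by apply: derivable_powR; rewrite in_itv/= a0.
exact: cvg_comp ua h.
Qed.

End sequences.

Arguments cvg_seq_cst {R} a _ _.
Arguments cvg_seqZ {R c u a} _ _ _.
Arguments cvg_seqX {R u a m} _ _ _.


(** * Asymptotics *)

Section asymptotics.
Context (R : realType) (k : nat) (r vs_lo vs_up s_up : R).
Context (l eps rho : nat -> R) (K : nat -> nat).
Hypothesis k1 : (1 <= k)%N.
Hypothesis r0 : 0 < r.
Hypothesis vs_lo0 : 0 < vs_lo.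
Hypothesis vs_up0 : 0 < vs_up.
Hypothesis s_up0 : 0 <= s_up.
Hypothesis l0 : forall n, (0 < n)%N -> 0 < l n.
Hypothesis l_small : forall delta : R, 0 < delta ->
  l n / n%:R `^ delta @[n --> \oo] --> (0 : R).
Hypothesis eps01 : forall n, (0 < n)%N -> 0 < eps n <= 1.
Hypothesis Koo : K n @[n --> \oo] --> \oo.
Hypothesis K_small : (K n)%:R / ln n%:R @[n --> \oo] --> (0 : R).
Hypothesis eps_cvg : eps n @[n --> \oo] --> (0 : R).
Hypothesis eps_big : forall delta : R, 0 < delta ->
  n%:R `^ delta * eps n @[n --> \oo] --> +oo.
Hypothesis rho_cvg : rho n @[n --> \oo] --> (0 : R).

Local Notation q := ((2 * k + 1)%:R^-1 : R).
Local Notation p := ((2 * k)%:R / (2 * k + 1)%:R : R).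
(** The ratio for which the bandwidth [omega_w] balances bias and variance under the
    largest noise level. *)
Definition target : R := r / vs_up.
(** The index, minus one, of the grid point just above [target]. *)
Definition node n := Num.truncn (target / eps n).
Let t n : R := (node n).+1%:R * eps n.
Let om n := omega_w n k (t n).
Let j0 n := Num.truncn (om n / ln n%:R).
Let x n := (tau_w R k * t n) `^ q.
Let xs := (tau_w R k * target) `^ q.
Let c : R := 2 * k%:R ^+ 2 / (k.+1%:R * (2 * k + 1)%:R).

Let q0 : 0 < q. Proof. by rewrite invr_gt0 ltr0n addn1. Qed.
Let target0 : 0 < target. Proof. by rewrite divr_gt0. Qed.
Let tau0 : 0 < tau_w R k. Proof. exact: tau_w_gt0. Qed.
Let pq : p + q = 1.
Proof. by rewrite -[X in _ + X]mul1r -mulrDl natr1 -addn1 divff// pnatr_eq0 addn1. Qed.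

Lemma node_cvg : t n @[n --> \oo] --> target.
Proof.
have h1 : (fun=> target) n @[n --> \oo] --> target by exact: cvg_cst.
have h2 : target + eps n @[n --> \oo] --> target.
  by have := cvg_seqD h1 eps_cvg; rewrite addr0.
apply: squeeze_cvgr _ h1 h2; near=> n.
have /andP[e0 e1] : 0 < eps n <= 1 by apply: eps01; near: n; exact: nbhs_infty_gt.
have te0 : 0 <= target / eps n by rewrite divr_ge0// ltW.
rewrite /t /node -ler_pdivrMr// (ltW (truncnS_gt _))/=.
rewrite -natr1 mulrDl mul1r lerD2r -ler_pdivlMr// truncn_le.
by [].
Unshelve. all: by end_near. Qed.

Lemma t_gt0 n : (0 < n)%N -> 0 < t n.
Proof. by move=> /eps01/andP[e0 _]; rewrite mulr_gt0 ?ltr0n. Qed.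

Lemma xs_gt0 : 0 < xs. Proof. by rewrite powR_gt0// mulr_gt0. Qed.

Lemma x_gt0 n : (0 < n)%N -> 0 < x n.
Proof. by move=> n0; rewrite powR_gt0// mulr_gt0// t_gt0. Qed.

Lemma x_cvg : x n @[n --> \oo] --> xs.
Proof.
apply: cvg_seq_powR; first by rewrite mulr_gt0.
by apply: cvg_seqZ; exact: node_cvg.
Qed.

Lemma omE n : (0 < n)%N -> om n = x n * n%:R `^ q.
Proof.
move=> n0; rewrite /om /omega_w powRM//.
by rewrite mulr_ge0 ?(ltW tau0)// ltW// t_gt0.
Qed.

Lemma om_gt0 n : (0 < n)%N -> 0 < om n.
Proof. by move=> n0; rewrite omE// mulr_gt0 ?x_gt0// powR_gt0 ?ltr0n. Qed.

Lemma ln_om_cvg : ln n%:R / om n @[n --> \oo] --> (0 : R).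
Proof.
apply: (@cvg_near_eq _ _ (fun n => (x n)^-1 * (ln n%:R / n%:R `^ q))).
  near=> n; have n0 : (0 < n)%N by near: n; exact: nbhs_infty_gt.
  by rewrite omE// invfM; ring.
rewrite -[X in _ --> X](mulr0 xs^-1); apply: cvg_seqM; last exact: ln_nat_powR.
by apply: cvg_seqV; [rewrite gt_eqF// xs_gt0|exact: x_cvg].
Unshelve. all: by end_near. Qed.

Lemma j0_large n : (0 < n)%N -> 1 <= ln (n%:R : R) -> ln n%:R / om n <= 1 / 2 ->
  (1 <= j0 n)%N /\ (j0 n)%:R^-1 <= 2 * (ln n%:R / om n).
Proof.
move=> n0 ln1 h.
have ln0 : 0 < ln (n%:R : R) by exact: lt_le_trans ln1.
have o0 := om_gt0 n0.
set y := om n / ln n%:R.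
have y0 : 0 < y by rewrite divr_gt0.
have yV : ln n%:R / om n = y^-1 by rewrite invf_div.
have y2 : 2 <= y.
  by move: h; rewrite yV div1r lef_pV2 ?posrE.
have hy : y < (j0 n).+1%:R by exact: truncnS_gt.
have jy : y / 2 <= (j0 n)%:R.
  by move: hy; rewrite -natr1; lra.
have j0R : 0 < (j0 n)%:R :> R by apply: lt_le_trans jy; rewrite divr_gt0.
split; first by rewrite -(ltr0n R).
rewrite yV -[X in X * _]invrK -invfM mulrC lef_pV2 ?posrE//.
by rewrite divr_gt0.
Qed.

Lemma j0_cvg : (j0 n)%:R^-1 @[n --> \oo] --> (0 : R).
Proof.
apply: (@cvg_squeeze0 _ _ (fun n => 2 * (ln n%:R / om n))); last first.
  by rewrite -[X in _ --> X](mulr0 2); apply: cvg_seqZ; exact: ln_om_cvg.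
have hh : \forall n \near \oo, ln n%:R / om n <= 1 / 2.
  by apply: (@cvgr_le _ _ _ _ _ _ ln_om_cvg (1 / 2)); rewrite divr_gt0.
near=> n; rewrite invr_ge0 ler0n/=.
have n0 : (0 < n)%N by near: n; exact: nbhs_infty_gt.
have ln1 : 1 <= ln (n%:R : R) by near: n; exact: ln_nat_near.
have h : ln n%:R / om n <= 1 / 2 by near: n.
by have [] := j0_large n0 ln1 h.
Unshelve. all: by end_near. Qed.

Lemma powR_pq n : (0 < n)%N -> n%:R `^ p / n%:R = (n%:R `^ q)^-1 :> R.
Proof.
move=> n0; have N0 : n%:R != 0 :> R by rewrite pnatr_eq0 -lt0n.
have h : n%:R `^ p * n%:R `^ q = n%:R :> R.
  by rewrite -powRD ?pq ?powRr1// N0 implybT.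
have qn : (n%:R : R) `^ q != 0 by rewrite gt_eqF// powR_gt0 ?ltr0n.
by apply: (mulIf qn); rewrite mulVf// mulrAC h divff.
Qed.

Lemma powR_bias n : (0 < n)%N -> n%:R `^ p * ((n%:R `^ q)^-1) ^+ (2 * k) = 1 :> R.
Proof.
move=> n0; have N0 : 0 < (n%:R : R) by rewrite ltr0n.
rewrite exprVn -powR_mulrn ?powR_ge0// -powRrM [q * _]mulrC divff//.
by rewrite gt_eqF// powR_gt0.
Qed.

Local Notation bias n := (bias_bound n k r (eps n) (node n)).
Local Notation sq n := (sqnorm_bound n k (eps n) (node n)).

Lemma sqnorm_scaled n : (0 < n)%N ->
  n%:R `^ p * (sq n / n%:R) = x n * ((ln n%:R)^-1 + c).
Proof.
move=> n0; rewrite /sqnorm_bound -/(t n) -/(om n) -/c omE//.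
have qn : (n%:R : R) `^ q != 0 by rewrite gt_eqF// powR_gt0 ?ltr0n.
transitivity (x n * ((ln n%:R)^-1 + c) *
  (n%:R `^ q * (n%:R `^ p / n%:R))); first by ring.
by rewrite powR_pq// divff// mulr1.
Qed.

Definition limit_value : R := r / (pi * xs) ^+ (2 * k) + vs_up * (c * xs).

Lemma main_cvg :
  n%:R `^ p * (bias n + r / n%:R + vs_up * sq n / n%:R) @[n --> \oo] --> limit_value.
Proof.
apply: (@cvg_near_eq _ _ (fun n => ((1 + (j0 n)%:R^-1) / (pi * x n)) ^+ (2 * k) * r
    + r * (n%:R `^ q)^-1 + vs_up * (x n * ((ln n%:R)^-1 + c)))).
  near=> n; have n0 : (0 < n)%N by near: n; exact: nbhs_infty_gt.
  rewrite 2!mulrDr.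
  have e1 : n%:R `^ p * bias n = ((1 + (j0 n)%:R^-1) / (pi * x n)) ^+ (2 * k) * r.
    rewrite /bias_bound -/(t n) -/(om n) -/(j0 n) omE//.
    have -> : (1 + (j0 n)%:R^-1) / (pi * (x n * n%:R `^ q)) =
        (1 + (j0 n)%:R^-1) / (pi * x n) * (n%:R `^ q)^-1 by rewrite mulrA invfM mulrA.
    by rewrite exprMn mulrA mulrCA powR_bias// mulr1.
  have e2 : n%:R `^ p * (r / n%:R) = r * (n%:R `^ q)^-1 by rewrite -powR_pq// mulrCA.
  have e3 : n%:R `^ p * (vs_up * sq n / n%:R) = vs_up * (x n * ((ln n%:R)^-1 + c)).
    by rewrite -sqnorm_scaled//; ring.
  by rewrite e1 e2 e3.
rewrite /limit_value -[r / _]addr0; apply: cvg_seqD; first apply: cvg_seqD.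
- rewrite mulrC -exprVn; apply: cvg_seqM; last exact: cvg_seq_cst.
  apply: cvg_seqX; rewrite -[X in _ --> X]mul1r; apply: cvg_seqM.
    by rewrite -[X in _ --> X]addr0; apply: cvg_seqD; [exact: cvg_seq_cst|exact: j0_cvg].
  apply: cvg_seqV; first by rewrite gt_eqF// mulr_gt0 ?pi_gt0 ?xs_gt0.
  by apply: cvg_seqZ; exact: x_cvg.
- by rewrite -[X in _ --> X](mulr0 r); apply: cvg_seqZ; exact: powR_nat_invV.
- apply: cvg_seqZ; rewrite mulrC; apply: cvg_seqM; first exact: x_cvg.
  by rewrite -[X in _ --> X]add0r; apply: cvg_seqD; [exact: ln_nat_invV|exact: cvg_seq_cst].
Unshelve. all: by end_near. Qed.

(** With [X = xs], the equation [X ^ (2 k + 1) = tau_w k * target] expresses the bias as the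
    fraction [1 / (2 k)] of the variance. Their sum [vs_up k X / (k + 1)] is the
    Pinsker constant. *)
Lemma limit_valueE : limit_value = pinsker_constant k r vs_up.
Proof.
have k0 : k%:R != 0 :> R by rewrite pnatr_eq0 -lt0n.
have kS0 : k.+1%:R != 0 :> R by rewrite pnatr_eq0.
have k20 : (2 * k + 1)%:R != 0 :> R by rewrite pnatr_eq0 addn1.
have pi0 : pi != 0 :> R by rewrite gt_eqF// pi_gt0.
have kS1 : k%:R + 1 != 0 :> R by rewrite natr1.
have k21 : 2 * k%:R + 1 != 0 :> R by rewrite -natrM natr1.
have vs_neq0 : vs_up != 0 by rewrite gt_eqF.
have r_neq0 : r != 0 by rewrite gt_eqF.
have X0 : xs != 0 by rewrite gt_eqF// xs_gt0.
have XE : xs ^+ (2 * k + 1) = tau_w R k * target.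
  rewrite /xs -powR_mulrn ?powR_ge0// -powRrM mulVf// powRr1//.
  by rewrite mulr_ge0// ltW.
pose B := vs_up * k%:R / (k.+1%:R * pi).
have B0 : 0 < B by rewrite divr_gt0 ?mulr_gt0 ?pi_gt0// ltr0n.
have -> : limit_value = B * pi * xs.
  rewrite /limit_value.
  have -> : r / (pi * xs) ^+ (2 * k) = xs * (r / (pi ^+ (2 * k) * xs ^+ (2 * k + 1))).
    by rewrite exprMn exprD expr1; field; rewrite X0 !expf_neq0.
  rewrite XE /tau_w /target /c /B -[k.+1%:R]natr1 natrD natrM.
  move: (pi) pi0 => P P0; field.
  by rewrite P0 kS1 k21 vs_neq0 k0 r_neq0 expf_neq0.
rewrite /pinsker_constant -/B.
pose D := pi ^+ (2 * k + 1) * B.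
have D0 : 0 < D by rewrite mulr_gt0// exprn_gt0// pi_gt0.
have -> : (2 * k + 1)%:R * r = tau_w R k * target * D.
  rewrite /tau_w /target /D /B exprD expr1 -[k.+1%:R]natr1.
  move: (pi) pi0 => P P0; field.
  by rewrite P0 kS1 vs_neq0 k0 expf_neq0.
rewrite powRM ?(ltW D0)//; last by rewrite mulr_ge0// ltW.
rewrite -/xs /D powRM ?(ltW B0) ?exprn_ge0 ?pi_ge0//.
rewrite -powR_mulrn ?pi_ge0// -powRrM divff// powRr1 ?pi_ge0//.
rewrite -[LHS]mulrA [LHS]mulrC -!mulrA -powRD.
  by rewrite [q + p]addrC pq powRr1 ?(ltW B0)//; ring.
by rewrite gt_eqF// implybT.
Qed.

Lemma powR_quarter (d : R) n : (0 < n)%N -> (n%:R : R) `^ d = (n%:R `^ (d / 4)) ^+ 4.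
Proof.
move=> n0; rewrite -powR_mulrn ?powR_ge0// -powRrM; congr (_ `^ _).
by rewrite divfK// pnatr_eq0.
Qed.

Lemma inv_eps_cvg d : 0 < d -> (n%:R `^ d * eps n)^-1 @[n --> \oo] --> (0 : R).
Proof. by move=> d0; apply: cvg_seqV_infty; exact: eps_big. Qed.

Lemma K_powR_cvg d : 0 < d -> (K n)%:R / n%:R `^ d @[n --> \oo] --> (0 : R).
Proof.
move=> d0; apply: (@cvg_near_eq _ _ (fun n => ((K n)%:R / ln n%:R) * (ln n%:R / n%:R `^ d))).
  near=> n; have ln1 : 1 <= ln (n%:R : R) by near: n; exact: ln_nat_near.
  by rewrite mulrA divfK// gt_eqF// (lt_le_trans _ ln1).
by have := cvg_seqM K_small (ln_nat_powR d0); rewrite mulr0.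
Unshelve. all: by end_near. Qed.

Lemma l_affine_cvg a b d : 0 < d -> (a + b * l n) / n%:R `^ d @[n --> \oo] --> (0 : R).
Proof.
move=> d0; apply: (@cvg_near_eq _ _ (fun n => a * (n%:R `^ d)^-1 + b * (l n / n%:R `^ d))).
  by apply: nearW => n; rewrite mulrDl mulrA.
have := cvg_seqD (cvg_seqZ (c := a) (powR_nat_invV d0)) (cvg_seqZ (c := b) (l_small d0)).
by rewrite !mulr0 addr0.
Qed.

(** The number of weights is at most [K / eps ^ 2]. Each of the four factors [l],
    [K], [1 / eps], [1 / eps] is smaller than a quarter of the available power. *)
Lemma noise_cvg eta : 0 < eta ->
  n%:R `^ p * (noise_level (K n) (eps n) eta s_up (l n) / n%:R) @[n --> \oo] --> (0 : R).
Proof.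
move=> eta0; have q40 : 0 < q / 4 by rewrite divr_gt0.
apply: (@cvg_squeeze0 _ _ (fun n => (2 * eta + 1 * l n) / n%:R `^ q +
   eta^-1 * (((2 * s_up + 5 * l n) / n%:R `^ (q / 4)) * ((K n)%:R / n%:R `^ (q / 4))
   * ((n%:R `^ (q / 4) * eps n)^-1) ^+ 2))); last first.
  have h := cvg_seqM (cvg_seqM (l_affine_cvg (2 * s_up) 5 q40) (K_powR_cvg q40))
    (cvg_seqX (m := 2) (inv_eps_cvg q40)).
  have := cvg_seqD (l_affine_cvg (2 * eta) 1 q0) (cvg_seqZ (c := eta^-1) h).
  by rewrite !mul0r mulr0 addr0.
near=> n; have n0 : (0 < n)%N by near: n; exact: nbhs_infty_gt.
have N0 : 0 < (n%:R : R) by rewrite ltr0n.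
have /andP[e0 e1] := eps01 n0; have ln0 := l0 n0.
rewrite mulrCA powR_pq// /noise_level.
have y0 : 0 < (n%:R : R) `^ (q / 4) by rewrite powR_gt0.
rewrite [n%:R `^ q]powR_quarter//; move: (n%:R `^ (q / 4)) y0 => y y0.
have T0 : 0 <= 2 * s_up + 5 * l n by rewrite addr_ge0 ?mulr_ge0 ?(ltW ln0).
rewrite -[_ *+ (K n * _)]mulr_natr natrM.
have M0 : (Num.truncn (eps n ^- 2))%:R <= eps n ^- 2.
  by rewrite truncn_le invr_ge0 exprn_ge0// ltW.
apply/andP; split.
  by rewrite mulr_ge0 ?invr_ge0 ?exprn_ge0 ?(ltW y0)// !addr_ge0 ?mulr_ge0 ?invr_ge0 ?(ltW ln0) ?(ltW eta0).
have h : (2 * s_up + 5 * l n) * ((K n)%:R * (Num.truncn (eps n ^- 2))%:R) / eta / y ^+ 4 <=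
  (2 * s_up + 5 * l n) * ((K n)%:R * eps n ^- 2) / eta / y ^+ 4.
  rewrite ler_pM2r ?invr_gt0 ?exprn_gt0// ler_pM2r ?invr_gt0//.
  by rewrite ler_wpM2l// ler_wpM2l.
rewrite mulrDl; apply: le_trans (lerD (lexx _) h) _.
rewrite mul1r [l n + _]addrC lerD2l le_eqVlt; apply/orP; left; apply/eqP.
by field; rewrite !gt_eqF.
Unshelve. all: by end_near. Qed.

Lemma variance_cvg : variance_bound n r vs_up s_up (l n) @[n --> \oo] --> (0 : R).
Proof.
have h0 : 0 < 2^-1 :> R by rewrite invr_gt0.
apply: (@cvg_near_eq _ _ (fun n => (2 + r + s_up * r + vs_up + 2 * l n) / n%:R `^ 2^-1)).
  by apply: nearW => n; rewrite /variance_bound powR12_sqrt//; congr (_ / _); ring.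
exact: l_affine_cvg.
Qed.

(** [n ^ (-1/2)] from the variance estimator against [n ^ (1/3)] from the mass
    leaves [n ^ (-1/6)], half of which absorbs [l] and half [1 / eps]. *)
Lemma variance_omega_cvg :
  n%:R `^ p * (variance_bound n r vs_up s_up (l n) * omega_bound n (eps n) / n%:R)
    @[n --> \oo] --> (0 : R).
Proof.
have d0 : 0 < 12^-1 :> R by rewrite invr_gt0.
apply: (@cvg_squeeze0 _ _ (fun n => 6 * (((2 + r + s_up * r + vs_up + 2 * l n) / n%:R `^ 12^-1)
   * (n%:R `^ 12^-1 * eps n)^-1))); last first.
  have := cvg_seqZ (c := 6) (cvg_seqM (l_affine_cvg (2 + r + s_up * r + vs_up) 2 d0) (inv_eps_cvg d0)).
  by rewrite !mul0r mulr0.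
near=> n; have n0 : (0 < n)%N by near: n; exact: nbhs_infty_gt.
have N0 : 0 < (n%:R : R) by rewrite ltr0n.
have N1 : 1 <= (n%:R : R) by rewrite ler1n.
have /andP[e0 e1] := eps01 n0; have ln0 := l0 n0.
set C := 2 + r + s_up * r + vs_up + 2 * l n.
have sr0 : 0 <= s_up * r by rewrite mulr_ge0// ltW.
have C0 : 0 < C by rewrite /C; move: r0 vs_up0 ln0 sr0; move: (s_up * r) (l n) => a b; lra.
have VE : variance_bound n r vs_up s_up (l n) = C / n%:R `^ 2^-1.
  by rewrite /variance_bound powR12_sqrt//; congr (_ / _); rewrite /C; ring.
have OM : omega_bound n (eps n) <= 6 * n%:R `^ 3^-1 / eps n.
  rewrite /omega_bound -mulrA mulrCA powRM ?divr_ge0 ?(ltW e0)//.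
  rewrite -mulrA mulrCA ler_pM2l ?powR_gt0//.
  apply: ler1_powR; last by rewrite invf_le1// ler1n.
  by rewrite ler_pdivlMr// mul1r (le_trans e1)// ler1n.
have OM0 : 0 <= omega_bound n (eps n) by exact: powR_ge0.
have y0 : 0 < (n%:R : R) `^ 12^-1 by rewrite powR_gt0.
have y2 : (n%:R : R) `^ 2^-1 = (n%:R `^ 12^-1) ^+ 6.
  by rewrite -powR_mulrn ?powR_ge0// -powRrM; congr (_ `^ _); field.
have y3 : (n%:R : R) `^ 3^-1 = (n%:R `^ 12^-1) ^+ 4.
  by rewrite -powR_mulrn ?powR_ge0// -powRrM; congr (_ `^ _); field.
have q1 : (n%:R `^ q)^-1 <= 1 :> R.
  rewrite invf_le1 ?powR_gt0// -[leLHS](powRr0 n%:R).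
  by apply: ler_powR => //; exact: ltW.
rewrite mulrCA powR_pq// VE; apply/andP; split.
  by rewrite mulr_ge0 ?invr_ge0 ?powR_ge0// mulr_ge0// divr_ge0 ?powR_ge0// ltW.
apply: (@le_trans _ _ (C / n%:R `^ 2^-1 * (6 * n%:R `^ 3^-1 / eps n) * 1)).
  apply: ler_pM; [|by rewrite invr_ge0 powR_ge0| |exact: q1].
    by rewrite mulr_ge0// divr_ge0 ?powR_ge0// ltW.
  by rewrite ler_wpM2l// divr_ge0 ?powR_ge0// ltW.
rewrite y2 y3 le_eqVlt; apply/orP; left; apply/eqP.
by move: (n%:R `^ 12^-1) y0 => y y0; field; rewrite !gt_eqF.
Unshelve. all: by end_near. Qed.

Lemma penalty_cvg :
  n%:R `^ p * (rho n * ((vs_up + variance_bound n r vs_up s_up (l n)) * sq n / n%:R))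
    @[n --> \oo] --> (0 : R).
Proof.
apply: (@cvg_near_eq _ _ (fun n => rho n *
   ((vs_up + variance_bound n r vs_up s_up (l n)) * (x n * ((ln n%:R)^-1 + c))))).
  near=> n; have n0 : (0 < n)%N by near: n; exact: nbhs_infty_gt.
  by rewrite -sqnorm_scaled//; ring.
have hV : vs_up + variance_bound n r vs_up s_up (l n) @[n --> \oo] --> vs_up + 0.
  by apply: cvg_seqD; [exact: cvg_seq_cst|exact: variance_cvg].
have hl : (ln n%:R)^-1 + c @[n --> \oo] --> 0 + c.
  by apply: cvg_seqD; [exact: ln_nat_invV|exact: cvg_seq_cst].
have := cvg_seqM rho_cvg (cvg_seqM hV (cvg_seqM x_cvg hl)).
by rewrite mul0r.
Unshelve. all: by end_near. Qed.

Lemma risk_bound_cvg eta : 0 < eta ->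
  n%:R `^ p * risk_bound n k (K n) r (eps n) (rho n) eta vs_lo vs_up s_up (l n) (node n)
    @[n --> \oo] -->
  (1 - eta * (1 + vs_lo^-1))^-1 * ((1 + eta * (1 + vs_lo^-1)) *
    ((1 + eta * (1 + vs_lo^-1)) * pinsker_constant k r vs_up)).
Proof.
move=> eta0; set u := eta * _.
have h := cvg_seqD (cvg_seqD (cvg_seqD (cvg_seqZ (c := 1 + u) main_cvg)
  (cvg_seqZ (c := 3) (noise_cvg eta0))) (cvg_seqZ (c := 4) variance_omega_cvg)) penalty_cvg.
have := cvg_seqZ (c := (1 - u)^-1) (cvg_seqZ (c := 1 + u) h).
rewrite !mulr0 !addr0 limit_valueE; apply: cvg_near_eq.
by apply: nearW => n; rewrite /risk_bound -/u; ring.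
Qed.

(** Only after the passage to the limit is [eta] sent to 0; for [u <= 1/2],
    [(1 + u) ^ 2 / (1 - u) <= 1 + 7 u]. *)
Lemma risk_bound_near (e : R) : 0 < e -> exists eta, [/\ 0 < eta,
  eta * (1 + vs_lo^-1) < 1 & (\forall n \near \oo,
  n%:R `^ p * risk_bound n k (K n) r (eps n) (rho n) eta vs_lo vs_up s_up (l n) (node n)
    <= pinsker_constant k r vs_up + e)].
Proof.
move=> e0; set A := pinsker_constant k r vs_up.
have A0 : 0 <= A by rewrite mulr_ge0 ?powR_ge0.
have w0 : 0 < 1 + vs_lo^-1 by rewrite addr_gt0 ?invr_gt0.
pose u := Num.min (1 / 2) (e / (14 * (A + 1))).
have d0 : 0 < 14 * (A + 1) by lra.
have u0 : 0 < u by rewrite lt_min !divr_gt0.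
have u2 : u <= 1 / 2 by rewrite ge_min lexx.
have uA : u * (14 * (A + 1)) <= e by rewrite -ler_pdivlMr// ge_min lexx orbT.
exists (u / (1 + vs_lo^-1)); rewrite divfK ?gt_eqF//; split.
- by rewrite divr_gt0.
- by lra.
have eta0 : 0 < u / (1 + vs_lo^-1) by rewrite divr_gt0.
have := risk_bound_cvg eta0; rewrite divfK ?gt_eqF// -/A => h.
apply: (@cvgr_le _ _ _ _ _ _ h (A + e)).
rewrite mulrC ltr_pdivrMr; last by lra.
have : (1 + u) * (1 + u) * A <= (1 + 7 * u) * (1 - u) * A.
  by rewrite ler_wpM2r//; nra.
have : (1 + 7 * u) * A < A + e by nra.
by nra.
Qed.

Lemma conditions_near : \forall n \near \oo, [/\ (0 < n)%N, 1 <= ln (n%:R : R),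
  omega_bound n (eps n) <= n%:R, (k <= K n)%N &
  (node n < Num.truncn (eps n ^- 2))%N /\ (1 <= j0 n)%N].
Proof.
have h1 : \forall n \near \oo, ln n%:R / om n <= 1 / 2.
  by apply: (@cvgr_le _ _ _ _ _ _ ln_om_cvg (1 / 2)); rewrite divr_gt0.
have h2 : \forall n \near \oo, 1 <= n%:R `^ 1 * eps n.
  by move: (eps_big ltr01) => /cvgryPge; apply.
have h3 : \forall n \near \oo, (k <= K n)%N by move/cvgnyPge : Koo; apply.
have h4 : \forall n \near \oo, eps n <= (target + 1)^-1.
  by apply: (@cvgr_le _ _ _ _ _ _ eps_cvg); rewrite invr_gt0 addr_gt0.
near=> n; have n0 : (0 < n)%N by near: n; exact: nbhs_infty_gt.
have ln1 : 1 <= ln (n%:R : R) by near: n; exact: ln_nat_near.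
have /andP[e0 e1] := eps01 n0.
split => //.
- have n6 : 6 <= (n%:R : R) by near: n; exact: nbhs_infty_ger.
  have : 1 <= n%:R `^ 1 * eps n by near: n.
  rewrite powRr1// => ne.
  (* [6 n / eps <= n ^ 3] follows from [6 <= n] and [1 / eps <= n]. *)
  have -> : (n%:R : R) = (n%:R ^+ 3) `^ 3^-1.
    by rewrite -powR_mulrn// -powRrM divff// powRr1.
  apply: ge0_ler_powR; rewrite ?nnegrE ?invr_ge0 ?exprn_ge0//.
  + by rewrite divr_ge0 ?mulr_ge0// ltW.
  rewrite ler_pdivrMr// !exprS expr0 mulr1.
  have : 6 * n%:R <= n%:R * n%:R * (n%:R * eps n) :> R.
    rewrite -[leLHS]mulr1; apply: ler_pM => //.
    by rewrite ler_wpM2r.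
  by rewrite !mulrA.
- by near: n.
split; last first.
  have hh : ln n%:R / om n <= 1 / 2 by near: n.
  by have [] := j0_large n0 ln1 hh.
have he : eps n <= (target + 1)^-1 by near: n.
  have T1 : 0 < target + 1 by rewrite addr_gt0.
  have te : eps n * (target + 1) <= 1 by rewrite -ler_pdivlMr// div1r.
  rewrite truncn_ge_nat; last by rewrite invr_ge0 exprn_ge0// ltW.
  apply: (@le_trans _ _ (target / eps n + 1)).
    by rewrite -natr1 lerD2r truncn_le divr_ge0// ltW.
  rewrite -[leRHS]div1r ler_pdivlMr ?exprn_gt0//.
  have -> : (target / eps n + 1) * eps n ^+ 2 = eps n * (target + eps n).
    by field; rewrite gt_eqF.
  by apply: le_trans te; rewrite ler_pM2l// lerD2l.
Unshelve. all: by end_near. Qed.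

End asymptotics.



(** * The upper bound *)

Lemma limn_esup_le_near (R : realType) (u : nat -> \bar R) (a : R) :
  (forall e : R, 0 < e -> \forall n \near \oo, (u n <= (a + e)%:E)%E) ->
  (limn_esup u <= a%:E)%E.
Proof.
move=> ue; apply/lee_addgt0Pr => e e0.
have [N _ uN] := ue e e0.
rewrite limn_esup_lim; apply: (@le_trans _ _ (esups u N)).
  apply: lime_le; first exact: is_cvg_esups.
  by near=> m; apply: nonincreasing_esups; near: m; exact: nbhs_infty_ge.
apply: ge_ereal_sup => _ [m /= Nm <-].
by rewrite -EFinD; exact: uN.
Unshelve. all: by end_near. Qed.

Theorem theorem6p2 (R : realType) (k : nat) (r : R)
  (Qn : forall n : nat, set (probability (DT (n%:R : R)) R))
  (I : forall n : nat, probability (DT (n%:R : R)) R ->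
         (R -> R) -> DT (n%:R : R) -> R)
  (sigma varsigma : forall n : nat, probability (DT (n%:R : R)) R -> R)
  (vs_lo vs_up sigma_up : R)
  (l : nat -> R) (kstar : nat -> nat) (eps rho : nat -> R)
  (gamma_hat : nat -> (R -> R) -> nat -> R) :
  (1 <= k)%N -> 0 < r ->
  (forall n Q, (0 < n)%N -> Qn n Q ->
     [/\ semimartingale_law Q, 0 < sigma n Q, 0 < varsigma n Q &
         stochastic_integral Q (sigma n Q) (I n Q)]) ->
  (forall n, (0 < n)%N -> 0 < l n) ->
  (forall m n, (0 < m)%N -> (m <= n)%N -> l m <= l n) ->
  l n @[n --> \oo] --> +oo ->
  (forall delta : R, 0 < delta ->
     l n / n%:R `^ delta @[n --> \oo] --> (0 : R)) ->
  (forall n Q, (0 < n)%N -> Qn n Q ->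
     (L1n Q (I n Q) (varsigma n Q) + L2n Q (I n Q) <= (l n)%:E)%E) ->
  0 < vs_lo ->
  (forall n, (0 < n)%N ->
     [/\ ereal_inf [set (varsigma n Q)%:E | Q in Qn n] = vs_lo%:E,
         ereal_sup [set (varsigma n Q)%:E | Q in Qn n] = vs_up%:E &
         ereal_sup [set (sigma n Q)%:E | Q in Qn n] = sigma_up%:E]) ->
  (forall n, (0 < n)%N -> (1 <= kstar n)%N /\ 0 < eps n <= 1) ->
  kstar n @[n --> \oo] --> \oo ->
  (kstar n)%:R / ln n%:R @[n --> \oo] --> (0 : R) ->
  eps n @[n --> \oo] --> (0 : R) ->
  (forall delta : R, 0 < delta ->
     n%:R `^ delta * eps n @[n --> \oo] --> +oo) ->
  (forall n, (0 < n)%N -> 0 < rho n) ->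
  rho n @[n --> \oo] --> (0 : R) ->
  (forall delta : R, 0 < delta ->
     n%:R `^ delta * rho n @[n --> \oo] --> +oo) ->
  (forall n y, (0 < n)%N ->
     Gamma_set n (kstar n) (eps n) (gamma_hat n y)) ->
  (forall n Q S, (0 < n)%N -> Qn n Q -> signal S ->
     (forall gam, Gamma_set n (kstar n) (eps n) gam ->
        measurable [set w : DT (n%:R : R) |
                      gamma_hat n (observation S w) = gam]) /\
     {ae Q, forall w,
        is_minimizer n (Gamma_set n (kstar n) (eps n)) (rho n)
          (theta_hat (I n Q) S w) (gamma_hat n (observation S w))}) ->
  (limn_esup (fun n : nat =>
     (n%:R `^ ((2 * k)%:R / (2 * k + 1)%:R))%:E *
     ereal_sup [set robust_risk (Qn n) (I n) (gamma_hat n) S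
                 | S in sobolev_ball k r])
   <= (pinsker_constant k r vs_up)%:E)%E.
Proof.
move=> k1 r0 model l0 _ _ l_small Lle vs_lo0 sups Keps Koo Ksmall eps_cvg eps_big
  rho0 rho_cvg _ range minim.
have eps01 n : (0 < n)%N -> 0 < eps n <= 1 by move=> /Keps[].
have vs_bounds n Q : (0 < n)%N -> Qn n Q ->
    [/\ vs_lo <= varsigma n Q, varsigma n Q <= vs_up & sigma n Q <= sigma_up].
  move=> n0 QQ; have [lo up sup] := sups n n0.
  split; rewrite -lee_fin.
  - by rewrite -lo; apply: ereal_inf_lbound; exists Q.
  - by rewrite -up; apply: ereal_sup_ubound; exists Q.
  - by rewrite -sup; apply: ereal_sup_ubound; exists Q.
(* The infimum over an empty family would be infinite. *)
have [Q1 Q1n] : exists Q, Qn 1%N Q.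
  have [lo _ _] := sups 1%N isT.
  apply/not_existsP => Q0; move: lo.
  rewrite (_ : [set _ | _ in _] = set0) ?ereal_inf0//.
  by apply/seteqP; split => // y [Q /Q0].
have vs_up0 : 0 < vs_up.
  have [h1 h2 _] := vs_bounds 1%N Q1 isT Q1n.
  exact: lt_le_trans vs_lo0 (le_trans h1 h2).
have s_up0 : 0 <= sigma_up.
  have [_ _ h] := vs_bounds 1%N Q1 isT Q1n.
  have [_ s0 _ _] := model 1%N Q1 isT Q1n.
  exact: ltW (lt_le_trans s0 h).
apply: limn_esup_le_near => e e0.
have [eta [eta0 u1 bound]] := risk_bound_near k1 r0 vs_lo0 vs_up0 s_up0 l0 l_small
  eps01 Ksmall eps_cvg eps_big rho_cvg e0.
have cond := conditions_near k1 r0 vs_up0 eps01 Koo eps_cvg eps_big.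
near=> n.
have [n0 ln1 omn kK [iM j01]] : [/\ (0 < n)%N, 1 <= ln (n%:R : R),
  omega_bound n (eps n) <= n%:R, (k <= kstar n)%N &
  (node r vs_up eps n < Num.truncn (eps n ^- 2))%N /\
  (1 <= Num.truncn (omega_w n k ((node r vs_up eps n).+1%:R * eps n) / ln n%:R))%N].
  by near: n; exact: cond.
have bn : n%:R `^ ((2 * k)%:R / (2 * k + 1)%:R) * risk_bound n k (kstar n) r (eps n)
    (rho n) eta vs_lo vs_up sigma_up (l n) (node r vs_up eps n) <=
    pinsker_constant k r vs_up + e by near: n; exact: bound.
have /andP[e_gt0 e_le1] := eps01 n n0.
apply: (@le_trans _ _ ((n%:R `^ ((2 * k)%:R / (2 * k + 1)%:R))%:E *
  (risk_bound n k (kstar n) r (eps n) (rho n) eta vs_lo vs_up sigma_up (l n)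
    (node r vs_up eps n))%:E)%E); last by rewrite -EFinM lee_fin.
rewrite lee_wpmul2l// ?lee_fin ?powR_ge0//.
apply: ge_ereal_sup => _ [S SB <-]; apply: ge_ereal_sup => _ [Q QQ <-].
have [_ s0 v0 SI] := model n Q n0 QQ.
have [v1 v2 s1] := vs_bounds n Q n0 QQ.
have sig : signal S.
  have [[pS dS cS bS] _] := SB; split => //.
  exact: L2_continuous (cS 0%N isT).
have [meas mini] := minim n Q S n0 QQ sig.
exact: (risk_le_bound n0 k1 r0 e_gt0 e_le1 (ltW (rho0 n n0)) eta0 vs_lo0 u1 ln1 omn kK
  iM j01 SI (ltW s0) s1 v1 v2 (Lle n Q n0 QQ) SB (range n ^~ n0) meas mini).
Unshelve. all: by end_near. Qed.
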